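(* Let $n>1$ be an integer, let $2<p<\infty$, and let $B,D\in O(n)$. Let $$K_p(B,D)=\left\{(x,y)\in\mathbb{R}^{n}\times\mathbb{R}^n:\ \|Bx\|_p^p+\|Dy\|_p^p\le 1\right\}\subset\mathbb{R}^{2n}.$$ Then for every normalized symplectic capacity $c$, $$c(K_p(B,D))^n< n!\,\mathrm{Vol}(K_p(B,D)).$$ If instead $p=2$ (with $n>1$ and $B,D\in O(n)$), then $c(K_2(B,D))^n=n!\,\mathrm{Vol}(K_2(B,D))$ for every normalized symplectic capacity $c$.
   Context: Coordinates on $\mathbb{R}^{2n}$ are ordered $(x_1,\ldots,x_n,y_1,\ldots,y_n)$, with the standard symplectic form $\omega=\sum_j dx_j\wedge dy_j$. $\|\cdot\|_p$ is the $\ell_p$ norm on $\mathbb{R}^n$, and $\mathrm{Vol}$ is Lebesgue measure on $\mathbb{R}^{2n}$. A normalized symplectic capacity is a map $c$ from subsets of $\mathbb{R}^{2n}$ to $[0,\infty]$ such that: $c(U)\le c(V)$ whenever $U$ embeds symplectically into $V$ (an embedding of a subset meaning the restriction of a symplectic embedding of an open neighborhood of it); $c(\lambda U)=\lambda^2c(U)$ for $\lambda>0$; and $c$ of the Euclidean unit ball and $c$ of the cylinder $\{x_1^2+y_1^2<1\}$ both equal $\pi$. *)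

(* Defs.v *)
From HB Require Import structures.
From mathcomp Require Import all_boot all_order all_algebra.
From mathcomp Require Import all_classical all_reals all_analysis.
Set Implicit Arguments.
Unset Strict Implicit.
Unset Printing Implicit Defensive.
Import Order.TTheory GRing.Theory Num.Theory.
Import numFieldNormedType.Exports.
Local Open Scope classical_set_scope.
Local Open Scope ring_scope.

(* A point of R^2n is a row vector z : 'rV[R]_(n + n); its x-part is lsubmx z
   and its y-part is rsubmx z. The topology of 'rV[R]_(n + n) in the library is
   that of the sup norm, i.e. the usual one. *)

Section Smooth.
Context {R : realType} {V W : normedModType R}.

(* Meant for open U, so that the junk values of f off U are irrelevant. *)
Fixpoint Ck_on (k : nat) (U : set V) (f : V -> W) : Prop :=
  match k with
  | 0 => forall z, U z -> {for z, continuous f}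
  | k'.+1 => (forall z, U z -> differentiable f z) /\
             (forall v : V, Ck_on k' U (fun z => 'D_v f z))
  end.

Definition smooth_on (U : set V) (f : V -> W) : Prop := forall k, Ck_on k U f.

End Smooth.

Section Symplectic.
Context {R : realType} {n : nat}.
Implicit Types U V : set 'rV[R]_(n + n).

Definition omega (u v : 'rV[R]_(n + n)) : R :=
  \sum_(j < n) (u 0 (lshift n j) * v 0 (rshift n j)
                - u 0 (rshift n j) * v 0 (lshift n j)).

(* The immersion condition of a smooth embedding follows from the preservation
   of omega, which is nondegenerate. *)
Definition open_symplectic_embedding U
    (phi : 'rV[R]_(n + n) -> 'rV[R]_(n + n)) : Prop :=
  [/\ open U,
      smooth_on U phi,
      (exists2 psi : 'rV[R]_(n + n) -> 'rV[R]_(n + n),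
         (forall z, U z -> psi (phi z) = z)
         & {within phi @` U, continuous psi})
    & forall z, U z -> forall u v,
        omega ('d phi z u) ('d phi z v) = omega u v].

Definition embeds_symplectically U V : Prop :=
  exists (U' : set 'rV[R]_(n + n)) (phi : 'rV[R]_(n + n) -> 'rV[R]_(n + n)),
    [/\ U `<=` U', open_symplectic_embedding U' phi & phi @` U `<=` V].

Definition euclidean_unit_ball : set 'rV[R]_(n + n) :=
  [set z | \sum_(i < n + n) z 0 i ^+ 2 < 1].

(* The coordinates (x_1, y_1) have index 0 in 'I_n; for n = 0 this set is the
   whole (one-point) space. *)
Definition unit_cylinder : set 'rV[R]_(n + n) :=
  [set z | forall i : 'I_n, nat_of_ord i = 0%N ->
             z 0 (lshift n i) ^+ 2 + z 0 (rshift n i) ^+ 2 < 1].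

Record normalized_symplectic_capacity
    (c : set 'rV[R]_(n + n) -> \bar R) : Prop := {
  capacity_ge0 : forall U, (0 <= c U)%E ;
  capacity_mono : forall U V, embeds_symplectically U V -> (c U <= c V)%E ;
  capacity_conformal : forall (lambda : R) U, 0 < lambda ->
    c [set lambda *: z | z in U] = ((lambda ^+ 2)%:E * c U)%E ;
  capacity_ball : c euclidean_unit_ball = (pi : R)%:E ;
  capacity_cylinder : c unit_cylinder = (pi : R)%:E }.

End Symplectic.

Section Volume.
Context {R : realType}.

(* The n-fold product measure of Lebesgue measure on R. Like lebesgue_measure
   and \x, it is a total set function, meaningful on Borel sets. *)
Fixpoint lebesgue_tuple (n : nat) :
    set (n.-tuple (measurableTypeR R)) -> \bar R :=
  match n return set (n.-tuple (measurableTypeR R)) -> \bar R with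
  | 0 => dirac [tuple]
  | m.+1 => fun A =>
      ((@lebesgue_measure R) \x (@lebesgue_tuple m))%E
        [set p | A (cons_tuple p.1 p.2)]
  end.

Definition Vol (n : nat) (A : set 'rV[R]_n) : \bar R :=
  lebesgue_tuple [set t : n.-tuple (measurableTypeR R) |
                    A (\row_(i < n) tnth t i)].

End Volume.

Section Bodies.
Context {R : realType} {n : nat}.

Definition orthogonal_matrix (B : 'M[R]_n) : Prop := B *m B^T = 1%:M.

Definition lp_norm (p : R) (v : 'rV[R]_n) : R :=
  (\sum_(i < n) `|v 0 i| `^ p) `^ p^-1.

(* Points being row vectors, x *m B^T is the transpose of the column B x. *)
Definition Kp (p : R) (B D : 'M[R]_n) : set 'rV[R]_(n + n) :=
  [set z | lp_norm p (lsubmx z *m B^T) `^ p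
           + lp_norm p (rsubmx z *m D^T) `^ p <= 1].

End Bodies.

(* Main.v *)
(* Write [kap = n^(1/2 - 1/p)] and let [A] be the area of the planar body
   [|s|^p + |t|^p <= 1].

   Upper bound on the capacity. The symplectic map [(x, y) |-> (Bx, By)] sends
   [K_p(B, D)] to a set whose first coordinates satisfy
   [|x_1|^p + |y_1 / kap|^p <= 1]: indeed [|(Bx)_1| <= ||Bx||_p], and
   [|(By)_1| <= ||y||_2 = ||Dy||_2 <= kap ||Dy||_p]. A smooth planar region
   [|t| < h(s)] slightly larger than this superellipse is mapped into a disc of
   almost the same area by [(s, t) |-> (r sin Th(s), r cos(Th(s)) t / h(s))],
   where [Th] matches the areas at the left of vertical lines. Hence
   [c(K_p(B, D)) <= kap A] for every normalized capacity [c].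

   Lower bound on the volume. Lebesgue measure is invariant under orthogonal
   matrices, so that the volume is that of the unit ball of [l_p] in dimension
   [2n]. Splitting off pairs of coordinates gives
   [A^n prod_(k < n) int_0^1 (1 - r^(p/2))^(2k/p) dr], and the [k]-th integral
   exceeds [(k + 1)^(-2/p)] for [k > 0], with equality throughout for [p = 2].
   Therefore [n! Vol > A^n (n!)^(1 - 2/p) >= A^n (n^n)^(1/2 - 1/p) = (kap A)^n]. *)

Require Import Defs.
From HB Require Import structures.
From mathcomp Require Import all_boot all_order all_algebra.
From mathcomp Require Import all_classical all_reals all_analysis.
From mathcomp Require Import measurable_realfun ring lra.
Set Implicit Arguments.
Unset Strict Implicit.
Unset Printing Implicit Defensive.
Import Order.TTheory GRing.Theory Num.Theory.
Import numFieldNormedType.Exports.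
Local Open Scope classical_set_scope.
Local Open Scope ring_scope.

(** * Lebesgue measure on tuples *)

(** The block matrix of [B] and [D] is symplectic only when the two coincide, so a linear symplectic
    map straightens only one of the two norms. The other is controlled through the Euclidean norm,
    which both matrices preserve, and this costs the factor [kap]. Volume, in contrast, is blind to
    the two rotations. Strictness comes entirely from the volume: the closed superellipse, whose
    boundary is not smooth for general [p], has to be enlarged before it is mapped, so the capacity
    argument yields a non-strict bound, as a limit. This is where [n > 1] enters: the ratio for
    [k = 0] is exactly 1, and the first strict one, [k = 1], needs two coordinate pairs. The loss
    [kap] is affordable because [n^n <= (n!)^2]. Invariance of volume under a matrix is derived from
    translation invariance and Tonelli, with the Euclidean ball as an invariant set of positive
    finite volume. For [p = 2] the body is the closed unit ball, whose capacity is squeezed between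
    those of the open ball and of its dilates; both sides are then [pi^n]. *)

Lemma product_measure1_sigma_finite d1 d2 (T1 : measurableType d1)
    (T2 : measurableType d2) (R : realType)
    (m1 : {sigma_finite_measure set T1 -> \bar R})
    (m2 : {sigma_finite_measure set T2 -> \bar R}) :
  sigma_finite setT (m1 \x m2)%E.
Proof.
have /sigma_finiteP[F [TF ndF Foo]] := sigma_finiteT m1.
have /sigma_finiteP[G [TG ndG Goo]] := sigma_finiteT m2.
(* The exhaustions are increasing, so the diagonal products already cover: a point caught at indices
   [n] and [k] is caught at their maximum. *)
exists (fun n => F n `*` G n).
  rewrite -setXTT TF TG; apply/seteqP; split => [[x y]|[x y]] /=.
    move=> [[n _ Fnx] [k _ Gky]]; exists (maxn n k) => //; split.
    - by move: x Fnx; exact/subsetPset/ndF/leq_maxl.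
    - by move: y Gky; exact/subsetPset/ndG/leq_maxr.
  by move=> [n _ [/= ? ?]]; split; exists n.
move=> k; have [? ?] := Foo k; have [? ?] := Goo k.
split; first exact: measurableX.
by rewrite product_measure1E// lte_mul_pinfty// ge0_fin_numE.
Qed.

Section SigmaFinitePack.
Context d (T : measurableType d) (R : realType).
Variable mu : {measure set T -> \bar R}.

(** Taking the hypothesis as an argument gives the copy a key of its own, to which a structure can
    be attached from a mere proposition about [mu]. *)
Definition sigma_finite_copy of sigma_finite setT mu : set T -> \bar R := mu.

Variable h : sigma_finite setT mu.
HB.instance Definition _ := Measure.on (sigma_finite_copy h).
HB.instance Definition _ := Measure_isSigmaFinite.Build _ _ _ (sigma_finite_copy h) h.

Lemma sigma_finite_measure_pack :
  {nu : {sigma_finite_measure set T -> \bar R} | nu = mu :> (set T -> \bar R)}.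
Proof. by exists (sigma_finite_copy h). Qed.

End SigmaFinitePack.

Section LebesgueTuple.
Context {R : realType}.
Local Open Scope ereal_scope.
Notation leb := (@lebesgue_measure R).
Notation T m := (m.-tuple (measurableTypeR R)).

Lemma measurable_cons_tuple m :
  measurable_fun setT (fun p : measurableTypeR R * T m => cons_tuple p.1 p.2 : T m.+1).
Proof. by apply: measurable_cons. Qed.

Lemma measurable_uncons m :
  measurable_fun setT (fun t : T m.+1 => (thead t, [tuple of behead t]) : measurableTypeR R * T m).
Proof.
apply/measurable_fun_pairP; split; first exact: measurable_tnth.
exact: measurable_behead.
Qed.

(** Product theory needs the measure on the tail as a bundled sigma-finite measure, so bundling goes
    by induction: the next measure is the pushforward of a product under [cons_tuple]. *)
Lemma lebesgue_tuple_sigma_finite_measure m :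
  {nu : {sigma_finite_measure set (T m) -> \bar R} |
    (nu : set (T m) -> \bar R) = @lebesgue_tuple R m}.
Proof.
elim: m => [|m [nu nuE]].
  by exists (dirac [tuple] : {sigma_finite_measure set (T 0) -> \bar R}).
pose cns := fun p : measurableTypeR R * T m => cons_tuple p.1 p.2 : T m.+1.
have mcns : measurable_fun setT cns by exact: measurable_cons_tuple.
pose mu' := pushforward (leb \x nu) cns : {measure set _ -> \bar R}.
pose mu := mu' mcns.
have muS : sigma_finite setT mu.
  have [F FT Foo] := product_measure1_sigma_finite leb nu.
  pose unc := fun t : T m.+1 => (thead t, [tuple of behead t]) : measurableTypeR R * T m.
  have cnsK p : unc (cns p) = p.
    by case: p => x t; rewrite /unc /cns /=; congr pair; apply: val_inj.
  exists (fun i => unc @^-1` F i).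
    by rewrite -preimage_bigcup -FT preimage_setT.
  move=> i; have [mF Fi] := Foo i; split.
    by rewrite -[X in measurable X]setTI; exact: measurable_uncons.
  rewrite /mu /= /pushforward /=.
  suff -> : cns @^-1` (unc @^-1` F i) = F i by [].
  by apply/seteqP; split => p /=; rewrite cnsK.
have [mus musE] := sigma_finite_measure_pack muS.
by exists mus; rewrite musE /= -nuE.
Qed.

Let lt0 m : @lebesgue_tuple R m set0 = 0.
Proof. by have [nu <-] := lebesgue_tuple_sigma_finite_measure m. Qed.

Let lt_ge0 m A : 0 <= @lebesgue_tuple R m A.
Proof. by have [nu <-] := lebesgue_tuple_sigma_finite_measure m. Qed.

Let lt_sigma m : semi_sigma_additive (@lebesgue_tuple R m).
Proof.
have [nu <-] := lebesgue_tuple_sigma_finite_measure m.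
exact: measure_semi_sigma_additive.
Qed.

HB.instance Definition _ m := isMeasure.Build _ _ _ (@lebesgue_tuple R m)
  (@lt0 m) (@lt_ge0 m) (@lt_sigma m).

Let lt_sigma_finite m : sigma_finite setT (@lebesgue_tuple R m).
Proof.
have [nu <-] := lebesgue_tuple_sigma_finite_measure m.
exact: sigma_finiteT.
Qed.

HB.instance Definition _ m := Measure_isSigmaFinite.Build _ _ _
  (@lebesgue_tuple R m) (@lt_sigma_finite m).

End LebesgueTuple.

Section LebesgueTupleTheory.
Context {R : realType}.
Local Open Scope ereal_scope.
Notation leb := (@lebesgue_measure R).
Notation T m := (m.-tuple (measurableTypeR R)).

Lemma lebesgue_tupleS m (A : set (T m.+1)) :
  lebesgue_tuple A = \int[leb]_x lebesgue_tuple [set t : T m | A (cons_tuple x t)].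
Proof.
rewrite /= /product_measure1; apply: eq_integral => x _ /=.
by congr lebesgue_tuple; apply/seteqP; split => t; rewrite /xsection /= inE.
Qed.

#[global] Arguments lebesgue_tuple : simpl never.

Lemma measurable_cons_section m (A : set (T m.+1)) x : measurable A ->
  measurable [set t : T m | A (cons_tuple x t)].
Proof.
move=> mA; rewrite -[X in measurable X]setTI.
by apply: (@measurable_cons _ _ _ _ (cst x) _ id) => //.
Qed.

Lemma measurable_fun_cons_section m (A : set (T m.+1)) : measurable A ->
  measurable_fun setT ((fun x => lebesgue_tuple [set t : T m | A (cons_tuple x t)])
    : measurableTypeR R -> \bar R).
Proof.
move=> mA.
have mB : measurable [set p : measurableTypeR R * T m | A (cons_tuple p.1 p.2)].
  by rewrite -[X in measurable X]setTI; exact: measurable_cons_tuple.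
apply: (eq_measurable_fun (@lebesgue_tuple R m \o xsection [set p | A (cons_tuple p.1 p.2)])).
  move=> x _ /=; congr lebesgue_tuple.
  by apply/seteqP; split => t; rewrite /xsection /= inE.
exact: measurable_fun_xsection.
Qed.

Lemma measurable_affine (a b : R) :
  measurable_fun setT (fun x : measurableTypeR R => (a * x + b)%R : measurableTypeR R).
Proof. by apply: measurable_funD => //; apply: measurable_funM. Qed.

(** [a] times the image measure agrees with Lebesgue measure on half-open intervals, and these
    determine it. *)
Lemma lebesgue_measure_affine (a b : R) (A : set (measurableTypeR R)) :
  (0 < a)%R -> measurable A ->
  leb [set x | A (a * x + b)%R] = (a^-1)%:E * leb A.
Proof.
move=> a0 mA.
pose f := fun x : measurableTypeR R => (a * x + b)%R : measurableTypeR R.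
have mf : measurable_fun setT f by exact: measurable_affine.
pose mu' := pushforward leb f : {measure set _ -> \bar R}.
have a0' : (0 <= a)%R by exact: ltW.
pose mu := mscale (NngNum a0') (mu' mf) : {measure set _ -> \bar R}.
have -> : leb A = mu A.
  apply: lebesgue_measure_unique => // X [[u v] /= _ <-].
  rewrite /mu /mscale /= /pushforward.
  have -> : f @^-1` `]u, v]%classic = `]((u - b) / a)%R, ((v - b) / a)%R]%classic.
    apply/seteqP; split => x; rewrite /f /= !in_itv/= ltr_pdivrMr// ler_pdivlMr// => /andP[? ?]; apply/andP; split; lra.
  rewrite !lebesgue_measure_itv /= !lte_fin ltr_pM2r ?invr_gt0// ltrD2r.
  case: ifPn => _; last by rewrite mule0.
  by rewrite -!EFinB -EFinM; congr EFin; field; rewrite gt_eqF.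
by rewrite /mu /mscale /= muleA -EFinM mulVf ?gt_eqF// mul1e.
Qed.

Lemma ge0_integral_affine (a b : R) (f : measurableTypeR R -> \bar R) :
  (0 < a)%R -> measurable_fun setT f -> (forall x, 0 <= f x) ->
  \int[leb]_x f (a * x + b)%R = (a^-1)%:E * \int[leb]_x f x.
Proof.
move=> a0 mf f0.
pose g := fun x : measurableTypeR R => (a * x + b)%R : measurableTypeR R.
have mg : measurable_fun setT g by exact: measurable_affine.
pose mu' := pushforward leb g : {measure set _ -> \bar R}.
have a0' : (0 <= a^-1)%R by rewrite invr_ge0 ltW.
transitivity (\int[mu' mg]_x f x).
  by rewrite ge0_integral_pushforward// preimage_setT.
transitivity (\int[mscale (NngNum a0') leb]_x f x).
  apply: eq_measure_integral => A mA _ /=.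
  by rewrite /pushforward /mscale /= -(lebesgue_measure_affine b).
by rewrite ge0_integral_mscale.
Qed.

Definition affine_tuple m (a : R) (b t : T m) : T m :=
  [tuple (a * tnth t i + tnth b i)%R | i < m].

Lemma affine_tuple_cons m (a x b0 : R) (b t : T m) :
  affine_tuple a (cons_tuple b0 b) (cons_tuple x t) =
  cons_tuple (a * x + b0)%R (affine_tuple a b t).
Proof.
apply: eq_from_tnth => i; rewrite tnth_mktuple.
by case: (unliftP ord0 i) => [j|] ->; rewrite ?tnthS ?tnth0 // tnth_mktuple.
Qed.

(** Covers two uses: translations for the invariance under matrices, dilations for the homogeneity
    of [lp_body]. *)
Lemma lebesgue_tuple_affine m (a : R) (b : T m) (A : set (T m)) :
  (0 < a)%R -> measurable A ->
  lebesgue_tuple [set t | A (affine_tuple a b t)] = (a ^- m)%:E * lebesgue_tuple A.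
Proof.
move=> a0; elim: m b A => [|m IH] b A mA.
  rewrite expr0 invr1 mul1e; congr lebesgue_tuple; apply/seteqP.
  by split=> t /=; rewrite (tuple0 t) (tuple0 (affine_tuple _ _ _)).
rewrite !lebesgue_tupleS.
pose F := (fun x => lebesgue_tuple [set t : T m | A (cons_tuple x t)])
    : measurableTypeR R -> \bar R.
have bE : b = cons_tuple (thead b) [tuple of behead b].
  by rewrite {1}(tuple_eta b); apply: val_inj.
have affine_bE (x : R) t : cons_tuple (a * x + thead b)%R (affine_tuple a [tuple of behead b] t) =
    affine_tuple a b (cons_tuple x t).
  by rewrite -affine_tuple_cons -bE.
under eq_integral => x _.
  rewrite (_ : [set t | _] = [set t : T m | [set t' | A (cons_tuple (a * x + thead b)%R t')]
     (affine_tuple a [tuple of behead b] t)]); last first.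
    by apply/seteqP; split => t /=; rewrite -[affine_tuple _ _ (cons_tuple _ _)]affine_bE.
  rewrite (IH [tuple of behead b] _ (measurable_cons_section _ mA)).
  over.
rewrite ge0_integralZl//; last 2 first.
- apply: (measurableT_comp (measurable_fun_cons_section mA)).
  exact: measurable_affine.
- by rewrite lee_fin invr_ge0 exprn_ge0// ltW.
rewrite (@ge0_integral_affine _ _ F)//; last exact: measurable_fun_cons_section.
by rewrite muleA -EFinM exprS invfM mulrC.
Qed.

End LebesgueTupleTheory.

Lemma integral_xsection_ysection d1 d2 (T1 : measurableType d1)
    (T2 : measurableType d2) (R : realType)
    (m1 : {sigma_finite_measure set T1 -> \bar R})
    (m2 : {sigma_finite_measure set T2 -> \bar R}) (A : set (T1 * T2)) :
  measurable A ->
  (\int[m1]_x m2 (xsection A x) = \int[m2]_y m1 (ysection A y))%E.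
Proof.
move=> mA; have := indic_fubini_tonelli m1 m2 mA.
by rewrite indic_fubini_tonelli_FE// indic_fubini_tonelli_GE.
Qed.

Lemma integral_cond_cst d (T : measurableType d) (R : realType)
    (mu : {measure set T -> \bar R}) (P : set T) (f : T -> \bar R) (c : \bar R) :
  measurable P -> (forall x, P x -> f x = c) -> (forall x, ~ P x -> f x = 0%E) ->
  (\int[mu]_x f x = c * mu P)%E.
Proof.
move=> mP fc f0; rewrite -integral_cst// [RHS]integral_mkcond.
apply: eq_integral => x _; rewrite patchE.
by case: ifPn => [/set_mem/fc|/negP xP]//; apply: f0 => Px; apply: xP; rewrite inE.
Qed.

(** * Volume of sets of row vectors, and its invariance under matrices *)

Section VolTheory.
Context {R : realType}.
Local Open Scope ereal_scope.
Notation leb := (@lebesgue_measure R).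
Notation T m := (m.-tuple (measurableTypeR R)).

Definition row_of_tuple m (t : T m) : 'rV[R]_m := \row_i tnth t i.
Definition tuple_of_row m (v : 'rV[R]_m) : T m := [tuple v 0%R i | i < m].

Lemma tuple_of_rowK m : cancel (@tuple_of_row m) (@row_of_tuple m).
Proof. by move=> v; apply/rowP => i; rewrite !mxE tnth_mktuple. Qed.

Lemma row_of_tuple_affine m (a : R) (b t : T m) :
  row_of_tuple (affine_tuple a b t) = (a *: row_of_tuple t + row_of_tuple b)%R.
Proof. by apply/rowP => i; rewrite !mxE tnth_mktuple. Qed.

Definition row_measurable m (A : set 'rV[R]_m) :=
  measurable [set t : T m | A (row_of_tuple t)].

Lemma measurable_mulmx m (M : 'M[R]_m) :
  measurable_fun setT (fun t : T m => tuple_of_row (row_of_tuple t *m M)%R).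
Proof.
apply/measurable_fun_tnthP => i.
apply: (eq_measurable_fun (fun t : T m => (\sum_j tnth t j * M j i)%R)).
  move=> t _ /=; rewrite tnth_mktuple mxE.
  by apply: eq_bigr => j _; rewrite mxE.
apply: measurable_sum => j.
by apply: measurable_funM => //; exact: measurable_tnth.
Qed.

Lemma row_measurable_mulmx m (M : 'M[R]_m) (A : set 'rV[R]_m) :
  row_measurable A -> row_measurable [set v | A (v *m M)%R].
Proof.
move=> mA; rewrite /row_measurable.
rewrite (_ : [set t | _] = (fun t : T m => tuple_of_row (row_of_tuple t *m M)%R) @^-1`
    [set t | A (row_of_tuple t)]); last first.
  by apply/seteqP; split => t /=; rewrite tuple_of_rowK.
by rewrite -[X in measurable X]setTI; exact: measurable_mulmx.
Qed.

Lemma Vol_affine m (a : R) (b : 'rV[R]_m) (A : set 'rV[R]_m) :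
  (0 < a)%R -> row_measurable A ->
  Vol [set v | A (a *: v + b)%R] = (a ^- m)%:E * Vol A.
Proof.
move=> a0 mA; rewrite /Vol -(lebesgue_tuple_affine (tuple_of_row b))//.
congr lebesgue_tuple; apply/seteqP.
by split => t /=; rewrite -/(row_of_tuple _) -/(row_of_tuple _) row_of_tuple_affine tuple_of_rowK.
Qed.

Lemma Vol_translate m (b : 'rV[R]_m) (A : set 'rV[R]_m) : row_measurable A ->
  Vol [set v | A (v + b)%R] = Vol A.
Proof.
move=> mA; rewrite -[RHS]mul1e -[1]/((1%R)%:E) -(invr1 R) -(expr1n R m).
rewrite -(@Vol_affine _ _ b)//; congr Vol; apply/seteqP.
by split => v /=; rewrite scale1r.
Qed.

(* Uniqueness of Haar measure: integrate the indicator of [E x * K (x + y)]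
   in both orders, [x] being twisted by [M]. *)
Lemma Vol_mulmx m (M N : 'M[R]_m) (E K : set 'rV[R]_m) :
  (N *m M)%R = 1%:M -> row_measurable E -> row_measurable K ->
  (forall v, E v -> E (- v)%R) -> (forall v, E (v *m M)%R <-> E v) ->
  0 < Vol E < +oo -> Vol [set v | K (v *m M)%R] = Vol K.
Proof.
move=> NM mE mK symE EM /andP[E0 Eoo].
pose nu := @lebesgue_tuple R m.
pose L := fun t : T m => (row_of_tuple t *m M)%R.
pose S := [set p : T m * T m | E (L p.1) /\ K (L p.1 + row_of_tuple p.2)%R].
pose S' := [set p : T m * T m | K (L p.1) /\ E (L p.1 - row_of_tuple p.2)%R].
have mL : measurable_fun setT (fun p : T m * T m => tuple_of_row (L p.1)).
  exact: (measurableT_comp (@measurable_mulmx m M)).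
have mLD (a : R) : measurable_fun setT (fun p : T m * T m =>
    tuple_of_row (L p.1 + a *: row_of_tuple p.2)%R).
  apply/measurable_fun_tnthP => i.
  apply: (eq_measurable_fun (fun p : T m * T m =>
      (tnth (tuple_of_row (L p.1)) i + a * tnth p.2 i)%R)).
    by move=> p _ /=; rewrite !tnth_mktuple !mxE.
  apply: measurable_funD.
    by apply: (measurableT_comp (@measurable_tnth _ _ m i)).
  apply: measurable_funM => //.
  by apply: (measurableT_comp (@measurable_tnth _ _ m i)).
have mpre d (U : measurableType d) (f : U -> 'rV[R]_m) A : row_measurable A ->
    measurable_fun setT (fun u => tuple_of_row (f u)) -> measurable [set u | A (f u)].
  move=> mA mf; rewrite (_ : [set u | _] = (fun u => tuple_of_row (f u)) @^-1`
      [set t | A (row_of_tuple t)]).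
    by rewrite -[X in measurable X]setTI; exact: mf.
  by apply/seteqP; split => u /=; rewrite tuple_of_rowK.
have mS : measurable S.
  apply: measurableI; first exact: (mpre _ _ (fun p : T m * T m => L p.1)).
  apply: (mpre _ _ (fun p : T m * T m => (L p.1 + row_of_tuple p.2)%R)) => //.
  by apply: eq_measurable_fun (mLD 1%R) => p _; rewrite scale1r.
have mS' : measurable S'.
  apply: measurableI; first exact: (mpre _ _ (fun p : T m * T m => L p.1)).
  apply: (mpre _ _ (fun p : T m * T m => (L p.1 - row_of_tuple p.2)%R)) => //.
  by apply: eq_measurable_fun (mLD (-1)%R) => p _; rewrite scaleN1r.
have mtr (A : set 'rV[R]_m) (b : 'rV[R]_m) : row_measurable A ->
    nu [set t | A (row_of_tuple t + b)%R] = Vol A.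
  by move=> mA; rewrite -(Vol_translate b mA).
have SE : \int[nu]_x nu (xsection S x) = Vol K * Vol E.
  rewrite (@integral_cond_cst _ _ _ _ [set x | E (L x)] _ (Vol K)).
  - by congr (_ * _); congr lebesgue_tuple; apply/seteqP; split => t /EM.
  - exact: row_measurable_mulmx.
  - move=> x Ex; rewrite -(mtr _ (L x) mK); congr (nu _).
    apply/seteqP; split => y; rewrite /xsection /= inE /S /= addrC; last by [].
    by case.
  - move=> x Ex; rewrite (_ : xsection S x = set0) ?measure0//.
    by apply/seteqP; split => y; rewrite /xsection /= inE /S //= => -[].
have S'E : \int[nu]_x nu (xsection S' x) = Vol E * Vol [set v | K (v *m M)%R].
  rewrite (@integral_cond_cst _ _ _ _ [set x | K (L x)] _ (Vol E)) //.
  - exact: row_measurable_mulmx.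
  - move=> x Kx; rewrite -(mtr _ (- L x)%R mE); congr (nu _).
    apply/seteqP; split => y; rewrite /xsection /= inE /S' /=.
      by move=> [_ /symE]; rewrite opprB.
    by move=> /symE; rewrite opprB.
  - move=> x Kx; rewrite (_ : xsection S' x = set0) ?measure0//.
    by apply/seteqP; split => y; rewrite /xsection /= inE /S' //= => -[].
(* For fixed [y], translating [x] by [y N] turns membership in [S'] into membership in [S], because
   [y N M = y]; the two sections therefore have the same measure. *)
have SS' : \int[nu]_x nu (xsection S x) = \int[nu]_x nu (xsection S' x).
  rewrite !integral_xsection_ysection//; apply: eq_integral => y _.
  have mSy : measurable (ysection S' y) by exact: measurable_ysection.
  transitivity (nu [set x | ysection S' y (affine_tuple 1 (tuple_of_row (row_of_tuple y *m N)%R) x)]).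
    congr (nu _); apply/seteqP; split => x; rewrite /ysection /= !inE /S /S' /= /L
      row_of_tuple_affine tuple_of_rowK scale1r mulmxDl -mulmxA NM mulmx1 addrK;
      by case.
  by rewrite [LHS]lebesgue_tuple_affine// expr1n invr1 mul1e.
have := SE; rewrite SS' S'E (muleC (Vol K)) => /esym/eqP.
have Ef : Vol E \is a fin_num by rewrite ge0_fin_numE// ltW.
have := E0; rewrite -(fineK Ef) lte_fin => e0.
move=> /eqP h; have : (fine (Vol E))^-1%:E * ((fine (Vol E))%:E * Vol K) =
  (fine (Vol E))^-1%:E * ((fine (Vol E))%:E * Vol [set v | K (v *m M)%R]) by rewrite h.
by rewrite !muleA -EFinM mulVf ?gt_eqF// !mul1e.
Qed.

End VolTheory.

(** * Volumes of the unit balls of the p-norms *)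

Section LpBody.
Context {R : realType}.
Local Open Scope ereal_scope.
Notation leb := (@lebesgue_measure R).
Notation T m := (m.-tuple (measurableTypeR R)).
Implicit Types p rho : R.

Definition lp_sum p m (t : T m) : R := (\sum_(i < m) `|tnth t i| `^ p)%R.

Definition lp_body p m rho : set (T m) := [set t | (lp_sum p t <= rho)%R].

Lemma lp_sum_cons p m (x : R) (t : T m) :
  lp_sum p (cons_tuple x t) = (`|x| `^ p + lp_sum p t)%R.
Proof.
rewrite /lp_sum big_ord_recl tnth0; congr +%R.
by apply: eq_bigr => i _; rewrite tnthS.
Qed.

Lemma lp_sum_ge0 p m (t : T m) : (0 <= lp_sum p t)%R.
Proof. by apply: sumr_ge0 => i _; exact: powR_ge0. Qed.

Lemma measurable_powR_abs p : measurable_fun setT (fun x : measurableTypeR R => (`|x| `^ p)%R : measurableTypeR R).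
Proof. by apply: (measurableT_comp (measurable_powR p)). Qed.

Lemma measurable_lp_sum p m : measurable_fun setT (@lp_sum p m : _ -> measurableTypeR R).
Proof.
apply: measurable_sum => i.
by apply: (measurableT_comp (@measurable_powR_abs p)); exact: measurable_tnth.
Qed.

Lemma measurable_lp_body p m rho : measurable (@lp_body p m rho).
Proof.
rewrite /lp_body -[X in measurable X]setTI.
by apply: measurable_fun_le => //; exact: measurable_lp_sum.
Qed.

Lemma lp_body0 p m : (0 < p)%R -> lebesgue_tuple (@lp_body p m.+1 0) = 0.
Proof.
move=> p0; rewrite lebesgue_tupleS.
rewrite (@integral_cond_cst _ (measurableTypeR R) _ _ [set 0%R : R] _ (lebesgue_tuple (@lp_body p m 0))).
- rewrite [X in _ * X](_ : _ = 0) ?mule0//; exact: lebesgue_measure_set1.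
- exact: measurable_set1.
- move=> x -> ; congr lebesgue_tuple; apply/seteqP.
  by split=> t; rewrite /lp_body /= lp_sum_cons normr0 powR0 ?gt_eqF// add0r.
- move=> x /eqP x0; rewrite (_ : [set t | _] = set0) ?measure0//.
  apply/seteqP; split => t //; rewrite /lp_body /= lp_sum_cons.
  apply/negP; rewrite -ltNge ltr_wpDr ?lp_sum_ge0// powR_gt0// normr_gt0.
  exact: x0.
Qed.

Lemma lebesgue_lp_body p m rho : (0 < p)%R -> (0 <= rho)%R ->
  lebesgue_tuple (@lp_body p m rho) =
  (rho `^ (m%:R / p))%:E * lebesgue_tuple (@lp_body p m 1).
Proof.
move=> p0; rewrite le_eqVlt => /predU1P[<-|rho0].
  (* Level 0 is out of reach of a dilation. In dimension 0 the formula holds because [0 ^ 0] is 1;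
     otherwise both sides vanish. *)
  case: m => [|m].
    rewrite mul0r powRr0 mul1e; congr lebesgue_tuple; apply/seteqP.
    by split => t; rewrite /lp_body /lp_sum /= big_ord0 // => _; exact: ler01.
  by rewrite lp_body0// powR0 ?mul0e// mulf_neq0 ?invr_neq0 ?gt_eqF// pnatr_eq0.
pose a := (rho `^ (- p^-1))%R.
have a0 : (0 < a)%R by exact: powR_gt0.
have ap : (a `^ p = rho^-1)%R.
  by rewrite /a -powRrM mulNr mulVf ?gt_eqF// powR_inv1// ltW.
pose z : T m := [tuple 0%R | i < m].
transitivity (lebesgue_tuple [set t | @lp_body p m 1 (affine_tuple a z t)]).
  congr lebesgue_tuple; apply/seteqP; split => t; rewrite /lp_body /lp_sum /=;
  (have -> : (\sum_(i < m) `|tnth (affine_tuple a z t) i| `^ p =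
    rho^-1 * \sum_(i < m) `|tnth t i| `^ p)%R by
    rewrite mulr_sumr; apply: eq_bigr => i _;
    rewrite !tnth_mktuple addr0 normrM powRM// (gtr0_norm a0) ap);
  by rewrite ler_pdivrMl// mulr1.
rewrite lebesgue_tuple_affine//; last exact: measurable_lp_body.
congr (_%:E * _); rewrite /a -powR_mulrn ?powR_ge0// -powRrM -powRN; congr powR.
by rewrite mulNr opprK mulrC.
Qed.

Lemma lp_body_lt0 p m rho : (rho < 0)%R -> lp_body p rho = set0 :> set (T m).
Proof.
move=> h; apply/seteqP; split => t //; rewrite /lp_body /=.
by rewrite leNgt (lt_le_trans h (lp_sum_ge0 p t)).
Qed.

Lemma one_powR (a : R) : (1 `^ a)%R = 1%R :> R.
Proof. by rewrite powR1. Qed.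

Lemma powR_le_inv p (x y : R) : (0 < p)%R -> (0 <= x)%R -> (0 <= y)%R ->
  (x `^ p <= y)%R = (x <= y `^ p^-1)%R.
Proof.
move=> p0 x0 y0; apply/idP/idP => h.
  have := @ge0_ler_powR _ p^-1 _ _ _ _ _ h; rewrite !nnegrE invr_ge0 ltW//.
  by rewrite -powRrM mulfV ?gt_eqF// powRr1//; apply => //; exact: powR_ge0.
have := @ge0_ler_powR _ p _ _ _ _ _ h; rewrite !nnegrE ltW//.
by rewrite -powRrM mulVf ?gt_eqF// powRr1//; apply => //; exact: powR_ge0.
Qed.

Lemma lebesgue_lp_body2 p rho :  (0 < p)%R ->
  lebesgue_tuple (@lp_body p 2 rho) =
  \int[leb]_(x in [set x | (`|x| `^ p <= rho)%R]) (2 * (rho - `|x| `^ p) `^ p^-1)%:E.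
Proof.
move=> p0; rewrite lebesgue_tupleS [RHS]integral_mkcond; apply: eq_integral => x _.
rewrite patchE; case: ifPn => [/set_mem /= xr|/negP xr]; last first.
  rewrite (_ : [set t | _] = set0) ?measure0//; apply/seteqP; split => t //=.
  rewrite /lp_body /= lp_sum_cons => h; apply: xr; rewrite inE /=.
  by apply: le_trans h; rewrite lerDl lp_sum_ge0.
set y := ((rho - _) `^ _)%R.
have y0 : (0 <= y)%R by exact: powR_ge0.
rewrite lebesgue_tupleS.
rewrite (@integral_cond_cst _ (measurableTypeR R) _ _ `[(- y)%R, y]%classic _ 1).
- rewrite mul1e [LHS]lebesgue_measure_itv/= lte_fin; case: ifPn => [h|h]; rewrite -?EFinB; congr EFin; move: h; rewrite -?leNgt; lra.
- exact: measurable_itv.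
- move=> u; rewrite /= in_itv /= -ler_norml => uy.
  rewrite (_ : [set t | _] = setT); first exact: diracT.
  apply/seteqP; split => t //= _; rewrite /lp_body /= !lp_sum_cons /lp_sum big_ord0 addr0.
  by rewrite addrC -lerBrDr powR_le_inv// subr_ge0.
- move=> u; rewrite /= in_itv /= -ler_norml => uy.
  rewrite (_ : [set t | _] = set0) ?measure0//; apply/seteqP; split => t //=.
  rewrite /lp_body /= !lp_sum_cons /lp_sum big_ord0 addr0 => h; apply: uy.
  by rewrite -powR_le_inv// ?subr_ge0// lerBrDr addrC.
Qed.

Lemma lebesgue_tuple2_fin_num p : (0 < p)%R ->
  lebesgue_tuple (@lp_body p 2 1) \is a fin_num.
Proof.
move=> p0; rewrite ge0_fin_numE ?measure_ge0// lebesgue_lp_body2//.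
have mD : measurable [set x : measurableTypeR R | (`|x| `^ p <= 1)%R].
  rewrite -[X in measurable X]setTI.
  by apply: measurable_fun_le => //; exact: measurable_powR_abs.
apply: (@le_lt_trans _ _ (\int[leb]_(x in `[(- 1)%R, 1%R]) 2%:E)).
  rewrite (_ : [set x | _] = `[(- 1)%R, 1%R]%classic); last first.
    apply/seteqP; split => x; rewrite /= in_itv /= -ler_norml powR_le_inv// powR1//.
  apply: ge0_le_integral => //.
  - by move=> x _; rewrite lee_fin mulr_ge0// powR_ge0.
  - apply/measurable_EFinP; apply: measurable_funM => //.
    apply: (measurableT_comp (measurable_powR _)) => //.
    by apply: measurable_funB => //; apply: measurable_funTS; exact: measurable_powR_abs.
  - move=> x; rewrite /= in_itv /= -ler_norml => x1; rewrite lee_fin.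
    rewrite -[leRHS]mulr1 ler_pM2l// -[leRHS](one_powR (p^-1)%R).
    have xp : (`|x| `^ p <= 1)%R by rewrite powR_le_inv// powR1.
    apply: ge0_ler_powR; rewrite ?nnegrE ?subr_ge0 ?gerBl ?powR_ge0//.
    by rewrite invr_ge0 ltW.
rewrite integral_cst// [X in _ * X](_ : _ = 2%:E) -?EFinM ?ltry//.
by rewrite [LHS]lebesgue_measure_itv /= lte_fin ifT -?EFinB; [congr EFin; lra|lra].
Qed.

(** The planar measure is bundled as sigma-finite because Tonelli will be applied to the plane times
    the remaining coordinates. *)
Let leb2 := sval (sigma_finite_measure_pack (product_measure1_sigma_finite leb leb)).

Let leb2E : leb2 = (leb \x leb)%E :> (set _ -> \bar R).
Proof. exact: (svalP (sigma_finite_measure_pack _)). Qed.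

Lemma lebesgue_tupleSS m (A : set (T m.+2)) : measurable A ->
  lebesgue_tuple A = \int[leb2]_u lebesgue_tuple [set t : T m | A (cons_tuple u.1 (cons_tuple u.2 t))].
Proof.
move=> mA; rewrite lebesgue_tupleS.
pose f := (fun u : measurableTypeR R * measurableTypeR R =>
  lebesgue_tuple [set t : T m | A (cons_tuple u.1 (cons_tuple u.2 t))]) : _ -> \bar R.
pose S := [set q : (measurableTypeR R * measurableTypeR R) * T m | A (cons_tuple q.1.1 (cons_tuple q.1.2 q.2))].
have mS : measurable S.
  rewrite -[X in measurable X]setTI.
  apply: (@measurable_cons _ _ _ _ (fun q => q.1.1) _ (fun q => cons_tuple q.1.2 q.2)) => //.
  - by apply: measurableT_comp.
  - by apply: measurable_cons => //; apply: measurableT_comp.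
have fE : f = @lebesgue_tuple R m \o xsection S.
  apply/funext => u; rewrite /f /=; congr lebesgue_tuple.
  by apply/seteqP; split => t; rewrite /xsection /= inE.
have mf : measurable_fun setT f by rewrite fE; exact: measurable_fun_xsection.
transitivity (\int[leb \x leb]_u f u); last by rewrite -leb2E.
have f0 u : 0 <= f u by exact: measure_ge0.
rewrite (@fubini_tonelli1 _ _ _ _ R leb leb f mf f0); apply: eq_integral => x _.
by rewrite lebesgue_tupleS; apply: eq_integral.
Qed.

(* The two first coordinates enter only through [|x|^p + |y|^p], whose
   sublevel sets have the same areas, up to the factor [lp_body p 2 1], as
   those of [r^(p/2)] on the half-line. *)
Lemma lebesgue_lp_bodySS p m : (0 < p)%R ->
  lebesgue_tuple (@lp_body p m.+2 1) =
  lebesgue_tuple (@lp_body p 2 1) * lebesgue_tuple (@lp_body p m 1) *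
  \int[leb]_(r in `[0%R, 1%R]) ((1 - r `^ (p / 2)) `^ (m%:R / p))%:E.
Proof.
move=> p0.
have p20 : (0 < p / 2)%R by rewrite divr_gt0.
rewrite lebesgue_tupleSS; last exact: measurable_lp_body.
pose N (u : measurableTypeR R * measurableTypeR R) := (`|u.1| `^ p + `|u.2| `^ p)%R.
have mN : measurable_fun setT (N : _ -> measurableTypeR R).
  by apply: measurable_funD; apply: (measurableT_comp (@measurable_powR_abs p)).
pose S := [set q : (measurableTypeR R * measurableTypeR R) * T m | (N q.1 + lp_sum p q.2 <= 1)%R].
pose S' := [set q : measurableTypeR R * T m | (0 <= q.1)%R /\ (q.1 `^ (p / 2) + lp_sum p q.2 <= 1)%R].
have mS : measurable S.
  rewrite -[X in measurable X]setTI; apply: measurable_fun_le => //.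
  by apply: measurable_funD; [exact: (measurableT_comp mN)|exact: (measurableT_comp (@measurable_lp_sum p m))].
have mS' : measurable S'.
  apply: measurableI; rewrite -[X in measurable X]setTI; apply: measurable_fun_le => //.
  apply: measurable_funD; last exact: (measurableT_comp (@measurable_lp_sum p m)).
  exact: (measurableT_comp (measurable_powR _)).
transitivity (\int[leb2]_u lebesgue_tuple (xsection S u)).
  apply: eq_integral => u _; congr lebesgue_tuple; apply/seteqP.
  by split => t; rewrite /xsection /= inE /S /lp_body /= !lp_sum_cons addrA.
rewrite integral_xsection_ysection//.
have A2 rho : leb2 [set u | (N u <= rho)%R] = lebesgue_tuple (@lp_body p 2 rho).
  rewrite lebesgue_tupleSS; last exact: measurable_lp_body.
  rewrite (@integral_cond_cst _ _ _ _ [set u | (N u <= rho)%R] _ 1).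
  - by rewrite mul1e.
  - by rewrite -[X in measurable X]setTI; apply: measurable_fun_le.
  - move=> u uN; rewrite (_ : [set t | _] = setT); first exact: diracT.
    apply/seteqP; split => t //= _.
    by rewrite /lp_body /= !lp_sum_cons addrA /lp_sum big_ord0 addr0.
  - move=> u uN; rewrite (_ : [set t | _] = set0) ?measure0//.
    apply/seteqP; split => t //=.
    by rewrite /lp_body /= !lp_sum_cons addrA /lp_sum big_ord0 addr0.
have A1 rho : leb [set r | (0 <= r)%R /\ (r `^ (p / 2) <= rho)%R] =
    if (0 <= rho)%R then (rho `^ (2 / p))%:E else 0.
  case: ifPn => [rho0|].
    rewrite (_ : [set r | _] = `[0%R, (rho `^ (2 / p))%R]%classic); last first.
      apply/seteqP; split => r; rewrite /= in_itv /=.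
        by move=> [r0]; rewrite powR_le_inv// invf_div r0.
      by move=> /andP[r0]; rewrite powR_le_inv// invf_div.
    rewrite [LHS]lebesgue_measure_itv/= lte_fin; case: ltP => [_|h].
      by rewrite -EFinB subr0.
    by congr EFin; apply/eqP; rewrite eq_le h powR_ge0.
  rewrite -ltNge => rho0; rewrite (_ : [set r | _] = set0) ?measure0//.
  apply/seteqP; split => r //= [r0]; rewrite leNgt.
  by rewrite (lt_le_trans rho0)// powR_ge0.
(* Over each [t] both sections are sublevel sets at level [1 - lp_sum p t]. Their measures are
   proportional to the same power of the level, and both sets are empty when it is negative. *)
transitivity (\int[@lebesgue_tuple R m]_t (lebesgue_tuple (@lp_body p 2 1) * leb (ysection S' t))).
  apply: eq_integral => t _.
  rewrite (_ : ysection S t = [set u | (N u <= 1 - lp_sum p t)%R]); last first.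
    by apply/seteqP; split => u; rewrite /ysection /= inE /S /= lerBrDr.
  rewrite (_ : ysection S' t = [set r | (0 <= r)%R /\ (r `^ (p / 2) <= 1 - lp_sum p t)%R]); last first.
    by apply/seteqP; split => u; rewrite /ysection /= inE /S' /= lerBrDr.
  rewrite A2 A1; case: ifPn => [h|].
    by rewrite lebesgue_lp_body// muleC.
  by rewrite -ltNge => h; rewrite mule0 lp_body_lt0// measure0.
rewrite ge0_integralZl//; last exact: measurable_fun_ysection.
rewrite -muleA; congr (_ * _).
rewrite -integral_xsection_ysection//.
rewrite [in RHS]muleC -ge0_integralZr//; last 2 first.
- apply/measurable_EFinP; apply: (measurableT_comp (measurable_powR _)) => //.
  by apply: measurable_funB => //; apply: measurable_funTS; exact: measurable_powR.
- by move=> x _; rewrite lee_fin powR_ge0.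
rewrite [RHS]integral_mkcond; apply: eq_integral => r _; rewrite patchE.
case: ifPn => [/set_mem|/negP].
  rewrite /= in_itv /= => /andP[r0 r1].
  rewrite -lebesgue_lp_body//; last first.
    by rewrite subr_ge0 powR_le_inv// powR1.
  congr lebesgue_tuple; apply/seteqP; split => t; rewrite /xsection /= inE /S' /lp_body /= lerBrDl.
    by case.
  by [].
rewrite inE /= in_itv /= => h; rewrite (_ : xsection _ _ = set0) ?measure0//.
apply/seteqP; split => t //; rewrite /xsection /= inE /S' /= => -[r0 hr].
apply: h; rewrite r0 /= -[leRHS](one_powR ((p / 2)^-1)%R) -powR_le_inv//.
by apply: le_trans hr; rewrite lerDl lp_sum_ge0.
Qed.

End LpBody.

(** * One-dimensional integrals *)

Section IsDerivePointwise.
Context {R : realType} {V : normedModType R}.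
Implicit Types (f g : V -> R) (x v : V).

(** The derivative rules are restated with function bodies written out, so that they can be nested
    and matched by unification. *)
Lemma is_derive_ptD f g x v df dg : is_derive x v f df -> is_derive x v g dg ->
  is_derive x v (fun y => f y + g y) (df + dg).
Proof. exact: is_deriveD. Qed.

Lemma is_derive_ptB f g x v df dg : is_derive x v f df -> is_derive x v g dg ->
  is_derive x v (fun y => f y - g y) (df - dg).
Proof. exact: is_deriveB. Qed.

Lemma is_derive_ptM f g x v df dg : is_derive x v f df -> is_derive x v g dg ->
  is_derive x v (fun y => f y * g y) (f x * dg + g x * df).
Proof. exact: is_deriveM. Qed.

Lemma is_derive_ptX f x v df n : is_derive x v f df ->
  is_derive x v (fun y => f y ^+ n.+1) (n.+1%:R * f x ^+ n * df).
Proof.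
by move=> h; have := is_deriveX n.+1 h; rewrite exprfctE.
Qed.

Lemma is_derive_ptC (c : R) x v : is_derive x v (fun=> c) 0.
Proof. exact: is_derive_cst. Qed.

Lemma is_derive_ptcomp (g : R -> R) f x v dg : differentiable f x ->
  is_derive (f x) 1 g dg -> is_derive x v (fun y => g (f y)) (dg * 'D_v f x).
Proof.
move=> df [/derivable1_diffP dg1 <-].
have dgf : differentiable (fun y => g (f y)) x by exact: differentiable_comp.
split; first exact: diff_derivable.
rewrite !deriveE// diff_comp//= -[X in 'd g (f x) X]mulr1.
rewrite -[_ * 1]/('d f x v *: (1 : R)) linearZ /= [LHS]mulrC.
by rewrite -deriveE.
Qed.

End IsDerivePointwise.

Lemma is_derive_pt1comp {R : realType} (g f : R -> R) (x dg df : R) :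
  is_derive (f x) 1 g dg -> is_derive x 1 f df ->
  is_derive x 1 (fun y => g (f y)) (dg * df).
Proof.
move=> hg [/derivable1_diffP hf <-]; exact: is_derive_ptcomp.
Qed.

Section PosPow.
Context {R : realType}.
Implicit Types a x : R.

(* [x `^ a] is 1 for negative [x]; this variant is continuous. *)
Definition pos_powR a x : R := Num.max x 0 `^ a.

Lemma pos_powRE a x : 0 <= x -> pos_powR a x = x `^ a.
Proof. by move=> x0; rewrite /pos_powR max_l. Qed.

Lemma powR_expR x a : 0 < x -> x `^ a = expR (a * ln x).
Proof. by move=> x0; rewrite /powR gt_eqF. Qed.

Lemma pos_powR_le0 a x : a != 0 -> x <= 0 -> pos_powR a x = 0.
Proof. by move=> a0 x0; rewrite /pos_powR max_r// powR0. Qed.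

Lemma pos_powR_ge0 a x : 0 <= pos_powR a x.
Proof. exact: powR_ge0. Qed.

Lemma is_derive_pos_powR a x : 0 < x ->
  is_derive x 1 (pos_powR a) (a * x `^ (a - 1)).
Proof.
move=> x0; have [dx <-] := is_derive1_powR a x0.
have E : {near x, (fun y : R => y `^ a) =1 pos_powR a}.
  near=> y; rewrite pos_powRE// ltW//; near: y; exact: lt_nbhsr.
split; first exact: near_eq_derivable dx.
by apply/esym; apply: near_eq_derive E.
Unshelve. all: by end_near. Qed.

Lemma continuous_pos_powR a : 0 < a -> continuous (pos_powR a).
Proof.
move=> a0 x; have [x0|x0|->] := ltgtP x 0.
- have E : {near x, cst 0 =1 pos_powR a}.
    near=> y; rewrite pos_powR_le0// ?gt_eqF// ltW//; near: y.
    exact: lt_nbhsl.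
  rewrite /continuous_at pos_powR_le0 ?gt_eqF// 1?ltW//.
  by apply: cvg_trans; [exact: near_eq_cvg E | exact: cvg_cst].
- by apply/differentiable_continuous/derivable1_diffP; have [] := is_derive_pos_powR a x0.
- rewrite /continuous_at pos_powR_le0 ?gt_eqF//.
  apply/cvgrPdist_lt => e e0; near=> y.
  rewrite sub0r normrN ger0_norm ?pos_powR_ge0//.
  have [y0|y0] := leP y 0; first by rewrite pos_powR_le0// gt_eqF.
  (* [e] is written as [(e ^ (1/a)) ^ a], so the neighbourhood wanted is [y < e ^ (1/a)]. *)
  rewrite pos_powRE ?ltW// -[e](@powRr1 R) ?ltW// -(mulVf (lt0r_neq0 a0)) powRrM.
  apply: gt0_ltr_powR; rewrite ?nnegrE ?powR_ge0 ?ltW//; near: y.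
  by apply: lt_nbhsl; exact: powR_gt0.
Unshelve. all: by end_near. Qed.

End PosPow.

Section BetaIneq.
Context {R : realType}.
Notation leb := (@lebesgue_measure R).
Implicit Types a x al : R.

Lemma is_derive_parameterized_integral (F : R -> R) (l x : R) :
  continuous F -> l < x ->
  is_derive x 1 (fun y => (\int[leb]_(t in `[l, y]) F t)%R) (F x).
Proof.
move=> cF lx.
have iF : leb.-integrable `[l, x + 1] (EFin \o F).
  apply: continuous_compact_integrable; first exact: segment_compact.
  exact: continuous_subspaceT.
have x1 : x < x + 1 by rewrite ltrDl.
have [d e] := @continuous_FTC1_closed R F l x (x + 1) x1 iF lx (cF x).
by split; [exact: d|rewrite -derive1E; exact: e].
Qed.

Lemma Rintegral_itvD (F : R -> R) (a b c : R) : continuous F -> a <= b -> b <= c ->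
  (\int[leb]_(t in `[a, c]) F t = \int[leb]_(t in `[a, b]) F t + \int[leb]_(t in `[b, c]) F t)%R.
Proof.
move=> cF ab bc.
have iF : leb.-integrable `[a, c] (EFin \o F).
  apply: continuous_compact_integrable; first exact: segment_compact.
  exact: continuous_subspaceT.
have : `[a, c]%classic = `[a, b] `|` `]b, c] :> set R.
  by rewrite -itv_bndbnd_setU// bnd_simp.
move=> E; rewrite E Rintegral_setU//.
- congr (_ + _); rewrite /Rintegral integral_itv_obnd_cbnd//.
  apply/measurable_EFinP; apply: measurable_funTS.
  exact: continuous_measurable_fun.
- by rewrite -E.
- apply/disj_setPRL => x /=; rewrite !in_itv /= => /andP[bx _]; apply/negP.
  by rewrite negb_and -!ltNge bx orbT.
Qed.

(* Monotone rearrangement of [(1 - a)^j da] onto the uniform density, through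
   [b = 1 - (1 - a)^(j+1)] and the geometric mean [a^(1/al) b^(1 - 1/al)]
   (one-dimensional Prekopa-Leindler). *)
Lemma beta_integral_gt al (j : nat) : 1 < al -> (0 < j)%N ->
  (((j.+1%:R `^ (- al^-1))%:E < \int[leb]_(r in `[0%R, 1%R]) ((1 - r `^ al) `^ (j%:R / al))%:E)%E).
Proof.
move=> al1 j0.
have al0 : 0 < al by lra.
have [s sE] : exists s : R, s = al^-1 by exists al^-1.
have s0 : 0 < s by rewrite sE invr_gt0.
have s1 : s < 1 by rewrite sE invf_lt1.
have alE : al = s^-1 by rewrite sE invrK.
rewrite -sE.
pose e := j%:R / al.
have e0 : 0 < e by rewrite divr_gt0// ltr0n.
pose F := fun r => pos_powR e (1 - pos_powR al r).
have cF : continuous F.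
  move=> r; apply: (@continuous_comp _ _ _ (fun r => 1 - pos_powR al r) (pos_powR e)).
    by apply: cvgB; [exact: cvg_cst|exact: continuous_pos_powR].
  exact: continuous_pos_powR.
(* The lower limit is -1 rather than 0 so that [P] is differentiable at [t 0 = 0] too; the piece
   over [[-1, 0]] cancels at the end. *)
pose P := fun y => (\int[leb]_(t in `[-1, y]) F t)%R.
have dP x : 0 <= x -> is_derive x 1 P (F x).
  by move=> x0; apply: is_derive_parameterized_integral => //; lra.
pose b := fun a : R => 1 - (1 - a) ^+ j.+1.
pose t := fun a : R => pos_powR s a * pos_powR (1 - s) (b a).
pose k : R := j.+1%:R.
have k0 : 0 < k by rewrite ltr0n.
(* The claim is [D 0 < D 1], obtained from a positive derivative on the open interval. *)
pose D := fun a : R => P (t a) - k `^ (- s) * b a.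
have s10 : 0 < 1 - s by lra.
have db x : is_derive x 1 b (k * (1 - x) ^+ j).
  apply: (is_derive_eq (is_derive_ptB (is_derive_ptC 1 x 1) (is_derive_ptX j
    (is_derive_ptB (is_derive_ptC 1 x 1) (is_derive_id x 1))))).
  by rewrite /k; ring.
have ct : continuous t.
  move=> x; apply: cvgM; first exact: continuous_pos_powR.
  apply: (@continuous_comp _ _ _ b (pos_powR (1 - s))); last exact: continuous_pos_powR.
  by apply/differentiable_continuous/derivable1_diffP; have [] := db x.
have t_ge0 x : 0 <= t x by rewrite mulr_ge0// pos_powR_ge0.
have cD : continuous D.
  move=> x; apply: cvgB.
    apply: (@continuous_comp _ _ _ t P); first exact: ct.
    by apply/differentiable_continuous/derivable1_diffP; have [] := dP _ (t_ge0 x).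
  apply: cvgM; first exact: cvg_cst.
  by apply/differentiable_continuous/derivable1_diffP; have [] := db x.
have dD x : 0 < x < 1 -> exists2 d, is_derive x 1 D d & 0 < d.
  move=> /andP[x0 x1]; pose w := 1 - x.
  have w0 : 0 < w by rewrite subr_gt0.
  have w1 : w < 1 by rewrite /w ltrBlDr ltrDl.
  have wj0 : 0 < w ^+ j.+1 by exact: exprn_gt0.
  have bx0 : 0 < b x by rewrite subr_gt0 exprn_ilt1// ltW.
  have bx1 : b x < 1 by rewrite /b ltrBlDr ltrDl.
  pose db' := k * w ^+ j.
  have db0 : 0 < db' by rewrite mulr_gt0// exprn_gt0.
  pose X := x `^ (s - 1) * b x `^ (1 - s).
  pose Y := x `^ s * b x `^ (- s) * db'.
  have X0 : 0 < X by rewrite mulr_gt0// powR_gt0.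
  have Y0 : 0 < Y by apply: mulr_gt0 => //; apply: mulr_gt0; exact: powR_gt0.
  have dt : is_derive x 1 t (s * X + (1 - s) * Y).
    apply: (is_derive_eq (is_derive_ptM (is_derive_pos_powR s x0)
      (is_derive_pt1comp (is_derive_pos_powR (1 - s) bx0) (db x)))).
    rewrite !pos_powRE ?ltW// /X /Y /db' /w.
    rewrite (_ : 1 - s - 1 = - s); last by ring.
    by ring.
  (* Weighted arithmetic-geometric mean inequality for the two terms of the derivative of [t]: in
     [X^s Y^(1 - s)] the powers of [x] and of [b x] cancel. *)
  have young : db' `^ (1 - s) <= s * X + (1 - s) * Y.
    have := @conjugate_powR R (X `^ s) (Y `^ (1 - s)) s^-1 (1 - s)^-1 (powR_ge0 _ _) (powR_ge0 _ _).
    rewrite !invr_gt0 !invrK => /(_ s0 s10 (subrKC _ _)).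
    rewrite [s * X]mulrC [(1 - s) * Y]mulrC; rewrite -!powRrM !mulfV ?gt_eqF// (powRr1 (ltW X0)) (powRr1 (ltW Y0)).
    apply: le_trans; rewrite le_eqVlt; apply/orP; left; apply/eqP.
    have lnX : ln X = (s - 1) * ln x + (1 - s) * ln (b x).
      by rewrite /X lnM ?posrE ?powR_gt0// !ln_powR.
    have lnY : ln Y = s * ln x + - s * ln (b x) + ln db'.
      have p1 : 0 < x `^ s by exact: powR_gt0.
      have p2 : 0 < b x `^ (- s) by exact: powR_gt0.
      by rewrite /Y lnM ?posrE//; [rewrite lnM// !ln_powR|exact: mulr_gt0].
    by rewrite !powR_expR// lnX lnY -!expRD; congr expR; ring.
  (* [t x ^ al] is [x] times a positive power of [b x < 1]. This is the source of the strict
     inequality. *)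
  have tal : t x `^ al < x.
    rewrite /t !pos_powRE ?ltW// powRM ?powR_ge0// -!powRrM alE mulfV ?gt_eqF// powRr1 ?ltW//.
    rewrite gtr_pMr// -[ltRHS](one_powR ((1 - s) / s)).
    by rewrite gt0_ltr_powR ?divr_gt0// nnegrE ltW.
  have Ft : w `^ e < F (t x).
    rewrite /F (pos_powRE al)//.
    have w_lt : w < 1 - t x `^ al by rewrite /w ltrD2l ltrN2.
    rewrite pos_powRE; last by apply: ltW; exact: lt_trans w_lt.
    by rewrite gt0_ltr_powR// nnegrE ltW// (lt_trans w0).
  exists (F (t x) * (s * X + (1 - s) * Y) - k `^ (- s) * db').
    apply: (is_derive_eq (is_derive_ptB (is_derive_pt1comp (dP _ (t_ge0 x)) dt)
      (is_derive_ptM (is_derive_ptC (k `^ (- s)) x 1) (db x)))).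
    by rewrite /db' /w; ring.
  rewrite subr_gt0; apply: (@lt_le_trans _ _ (F (t x) * db' `^ (1 - s))).
    (* From [db' = k w^j] one gets [db'^s = k^s w^e], since [e = j s]. The factor [k^(-s)] in [D] is
       chosen for this cancellation. *)
    rewrite (_ : k `^ (- s) * db' = w `^ e * db' `^ (1 - s)).
      by rewrite ltr_pM2r// powR_gt0.
    have lnd : ln db' = ln k + j%:R * ln w.
      by rewrite /db' lnM ?posrE ?exprn_gt0// lnXn// mulr_natl.
    rewrite -[X in _ * X](powRr1 (ltW db0)) !powR_expR// lnd -!expRD; congr expR.
    by rewrite /e -sE; ring.
  by rewrite ler_wpM2l// pos_powR_ge0.
have D01 : D 0 < D 1.
  have := @gtr0_derive1_lt R D 0 1 _ _ true false _ 0 1.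
  rewrite !in_itv /= !lexx ler01 ltr01; apply => //.
  - by move=> x; rewrite in_itv /= => /dD[d [? _]].
  - by move=> x; rewrite in_itv /= derive1E => /dD[d [_ <-]].
  - exact: continuous_subspaceT.
have b0 : b 0 = 0 by rewrite /b subr0 expr1n subrr.
have b1 : b 1 = 1 by rewrite /b subrr expr0n /= subr0.
have t0 : t 0 = 0 by rewrite /t pos_powR_le0 ?mul0r// gt_eqF.
have t1 : t 1 = 1 by rewrite /t b1 !pos_powRE// !one_powR mulr1.
move: D01; rewrite /D b0 b1 t0 t1 mulr0 subr0 mulr1.
rewrite /P (@Rintegral_itvD F (-1) 0 1)//.
rewrite -addrA ltrDl subr_gt0 => h.
have -> : (\int[leb]_(r in `[0%R, 1%R]) ((1 - r `^ al) `^ (j%:R * s))%:E =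
  \int[leb]_(r in `[0%R, 1%R]) (F r)%:E)%E.
  apply: eq_integral => r; rewrite inE /= in_itv /= => /andP[r0 r1].
  rewrite /F /e -sE (pos_powRE al)// pos_powRE// subr_ge0 -[leRHS](one_powR al).
  by apply: ge0_ler_powR; rewrite ?nnegrE// ltW.
have iF : leb.-integrable `[0, 1] (EFin \o F).
  apply: continuous_compact_integrable; first exact: segment_compact.
  exact: continuous_subspaceT.
by rewrite -[ltRHS]fineK ?lte_fin//; exact: integrable_fin_num.
Qed.

End BetaIneq.

(** * Planar areas, and even-dimensional volumes as products over coordinate pairs *)

Section Areas.
Context {R : realType}.
Notation leb := (@lebesgue_measure R).
Implicit Types p : R.

Lemma integral_onem_pow (j : nat) :
  (\int[leb]_(r in `[0%R, 1%R]) ((1 - r) ^+ j)%:E = (j.+1%:R^-1)%:E)%E.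
Proof.
have j0 : j.+1%:R != 0 :> R by rewrite pnatr_eq0.
pose G := fun r : R => - j.+1%:R^-1 * (1 - r) ^+ j.+1.
have dG (x : R) : is_derive x 1 G ((1 - x) ^+ j).
  apply: (is_derive_eq (is_derive_ptM (is_derive_ptC (- j.+1%:R^-1) x 1)
    (is_derive_ptX j (is_derive_ptB (is_derive_ptC 1 x 1) (is_derive_id x 1))))).
  by field.
have cG : continuous G.
  by move=> x; apply/differentiable_continuous/derivable1_diffP; have [] := dG x.
have cg : continuous (fun r : R => (1 - r) ^+ j).
  move=> x; apply: (@continuous_comp _ _ _ (fun r : R => 1 - r) (fun y => y ^+ j)).
    by apply: cvgB; [exact: cvg_cst|exact: cvg_id].
  exact: exprn_continuous.
rewrite (@continuous_FTC2 _ _ G) ?ltr01//.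
- by rewrite /G subrr subr0 expr1n expr0n /= mulr0 mulr1 -EFinB sub0r opprK.
- exact: continuous_subspaceT.
- split; [by move=> x _; have [] := dG x| |].
    by apply: cvg_at_right_filter; exact: cG.
  by apply: cvg_at_left_filter; exact: cG.
- by move=> x _; rewrite derive1E; have [_ ->] := dG x.
Qed.

Lemma integral_half_disc :
  (\int[leb]_(x in `[(- 1)%R, 1%R]) (2 * Num.sqrt (1 - x ^+ 2))%:E = (pi : R)%:E)%E.
Proof.
have pi0 : 0 < pi / 2 :> R by rewrite divr_gt0// pi_gt0.
have ab : - (pi / 2) < pi / 2 :> R by lra.
have sinE : derive1 (@sin R) = cos.
  by apply/funext => x; rewrite derive1E; have [_ ->] := is_derive_sin x.
pose G := fun x : R => 2 * Num.sqrt (1 - x ^+ 2).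
have cG : continuous G.
  move=> x; apply: cvgM; first exact: cvg_cst.
  apply: (@continuous_comp _ _ _ (fun x : R => 1 - x ^+ 2) Num.sqrt).
    by apply: cvgB; [exact: cvg_cst|exact: exprn_continuous].
  exact: sqrt_continuous.
have := @integration_by_substitution_increasing R sin G _ _ (ltW ab).
rewrite sinN sin_pihalf => ->; last 6 first.
- by move=> x y xab yab xy; rewrite ltr_sin.
- by rewrite sinE => x _; exact: continuous_cos.
- rewrite sinE; apply/cvg_ex; exists (cos (- (pi / 2))).
  by apply: cvg_at_right_filter; exact: continuous_cos.
- rewrite sinE; apply/cvg_ex; exists (cos (pi / 2)).
  by apply: cvg_at_left_filter; exact: continuous_cos.
- split; [by move=> x _; apply: ex_derive; exact: is_derive_sin| |].
    by apply: cvg_at_right_filter; exact: continuous_sin.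
  by apply: cvg_at_left_filter; exact: continuous_sin.
- exact: continuous_subspaceT.
pose F := fun x : R => x + sin x * cos x.
have dF (x : R) : is_derive x 1 F (2 * cos x ^+ 2).
  apply: (is_derive_eq (is_derive_ptD (is_derive_id x 1)
    (is_derive_ptM (is_derive_sin x) (is_derive_cos x)))).
  by rewrite -expr2 mulrN -expr2 sin2cos2; ring.
have cF : continuous F.
  by move=> x; apply/differentiable_continuous/derivable1_diffP; have [] := dF x.
transitivity (\int[leb]_(x in `[(- (pi / 2))%R, (pi / 2)%R]) (2 * cos x ^+ 2)%:E)%E.
  apply: eq_integral => x; rewrite inE /= in_itv /= => xab; congr EFin.
  change (G (sin x) * derive1 sin x = 2 * cos x ^+ 2).
  rewrite /G -cos2sin2 sqrtr_sqr ger0_norm ?sinE ?cos_ge0_pihalf//.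
  by rewrite expr2 mulrA.
rewrite (@continuous_FTC2 _ _ F)//.
- rewrite /F cosN cos_pihalf !mulr0 !addr0 -EFinB; congr EFin; lra.
- apply: continuous_subspaceT => x; apply: cvgM; first exact: cvg_cst.
  apply: (@continuous_comp _ _ _ cos (fun y => y ^+ 2)).
    exact: continuous_cos.
  exact: exprn_continuous.
- split; [by move=> x _; have [] := dF x| |].
    by apply: cvg_at_right_filter; exact: cF.
  by apply: cvg_at_left_filter; exact: cF.
- by move=> x _; rewrite derive1E; have [_ ->] := dF x.
Qed.

Lemma lebesgue_disc : lebesgue_tuple (@lp_body R 2 2 1) = (pi : R)%:E.
Proof.
rewrite lebesgue_lp_body2// -integral_half_disc.
rewrite (_ : [set x | _] = `[(- 1)%R, 1%R]%classic); last first.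
  by apply/seteqP; split => x; rewrite /= in_itv /= -ler_norml powR_le_inv// one_powR.
apply: eq_integral => x; rewrite inE /= in_itv /= -ler_norml => x1.
congr (2 * _)%:E; rewrite (powR_mulrn 2)// real_normK ?num_real// powR12_sqrt//.
by rewrite subr_ge0 -real_normK ?num_real// expr_le1.
Qed.

(** The volume of the [l_p] unit ball in dimension [2k + 2], divided by the one in dimension [2k]
    and by the planar area. *)
Definition pair_ratio p (k : nat) : \bar R :=
  (\int[leb]_(r in `[0%R, 1%R]) ((1 - r `^ (p / 2)) `^ (k.*2%:R / p))%:E)%E.

Lemma pair_ratio0 p : pair_ratio p 0 = 1%E.
Proof.
rewrite /pair_ratio.
under eq_integral do rewrite mul0r powRr0.
by rewrite integral_cst// mul1e [LHS]lebesgue_measure_itv /= lte_fin ltr01 -EFinB subr0.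
Qed.

Lemma pair_ratio2 k : pair_ratio 2 k = (k.+1%:R^-1)%:E.
Proof.
rewrite -integral_onem_pow; apply: eq_integral => r.
rewrite inE /= in_itv /= => /andP[r0 r1].
rewrite divff// powRr1// -mul2n natrM mulrAC divff// mul1r powR_mulrn//.
by rewrite subr_ge0.
Qed.

Lemma pair_ratio_gt p k : 2 < p -> (0 < k)%N ->
  ((k.+1%:R `^ (- (2 / p)))%:E < pair_ratio p k)%E.
Proof.
move=> p2 k0; have p0 : 0 < p by lra.
have al1 : 1 < p / 2 by rewrite ltr_pdivlMr// mul1r.
have := beta_integral_gt al1 k0; rewrite invf_div.
by rewrite /pair_ratio -mul2n natrM [2 * k%:R]mulrC -mulrA.
Qed.

(** Serves to exclude infinite values when the strict lower bounds are multiplied together. *)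
Lemma pair_ratio_le1 p k : 0 < p -> (pair_ratio p k <= 1)%E.
Proof.
move=> p0.
have -> : 1%E = (\int[leb]_(r in `[0%R, 1%R]) 1)%E.
  by rewrite integral_cst// mul1e [RHS]lebesgue_measure_itv /= lte_fin ltr01 -EFinB subr0.
apply: ge0_le_integral => //.
- by move=> x _; rewrite lee_fin powR_ge0.
- apply/measurable_EFinP; apply: (measurableT_comp (measurable_powR _)) => //.
  by apply: measurable_funB => //; apply: measurable_funTS; exact: measurable_powR.
- move=> x; rewrite /= in_itv /= => /andP[x0 x1]; rewrite lee_fin.
  rewrite -[leRHS](one_powR (k.*2%:R / p)).
  apply: ge0_ler_powR; rewrite ?nnegrE ?divr_ge0 ?gerBl ?powR_ge0//; first exact: ltW.
  rewrite subr_ge0 -[leRHS](one_powR (p / 2)).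
  by apply: ge0_ler_powR; rewrite ?nnegrE ?divr_ge0//; exact: ltW.
Qed.

Lemma lebesgue_lp_body_even p n : 0 < p ->
  (lebesgue_tuple (@lp_body R p n.*2 1) =
   lebesgue_tuple (@lp_body R p 2 1) ^+ n * \prod_(k < n) pair_ratio p k)%E.
Proof.
move=> p0; elim: n => [|n IH].
  rewrite expe0 big_ord0 mul1e (_ : lp_body _ _ = setT); first exact: diracT.
  by apply/seteqP; split => t //= _; rewrite /lp_body /lp_sum /= big_ord0 ler01.
rewrite doubleS lebesgue_lp_bodySS// IH expeS big_ord_recr.
by rewrite !muleA.
Qed.

Lemma lebesgue_ball_even n :
  (lebesgue_tuple (@lp_body R 2 n.*2 1) = ((pi : R) ^+ n / n`!%:R)%:E)%E.
Proof.
rewrite lebesgue_lp_body_even// lebesgue_disc -EFin_expe EFinM; congr (_ * _)%E.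
elim: n => [|n IH]; first by rewrite big_ord0 fact0 invr1.
by rewrite big_ord_recr /= IH pair_ratio2 -EFinM -invfM -natrM factS mulnC.
Qed.

Lemma lebesgue_lp_body_even_gt p n (A : R) : 2 < p -> (1 < n)%N -> 0 < A ->
  lebesgue_tuple (@lp_body R p 2 1) = A%:E ->
  ((n`!%:R `^ (- (2 / p)) * A ^+ n)%:E < lebesgue_tuple (@lp_body R p n.*2 1))%E.
Proof.
move=> p2 n1 A0 AE; have p0 : 0 < p by lra.
rewrite lebesgue_lp_body_even// AE -EFin_expe mulrC EFinM.
rewrite lte_pmul2l ?lte_fin ?exprn_gt0//.
(* The induction starts at two pairs: the ratio for [k = 0] equals 1, and strictness first appears
   at [k = 1]. *)
case: n n1 => [//|[//|n] _]; elim: n => [|n IH].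
  by rewrite !big_ord_recl big_ord0 mule1 pair_ratio0 mul1e pair_ratio_gt.
rewrite big_ord_recr /= factS mulnC natrM powRM// EFinM.
have := pair_ratio_gt p2 (ltn0Sn n.+1).
move: IH; set P := (\prod_(k < n.+2) _)%E; set T := pair_ratio p n.+2.
have P1 : (P <= 1)%E.
  rewrite /P; elim: n.+2 => [|k IH]; first by rewrite big_ord0.
  rewrite big_ord_recr /= -[leRHS]mule1; apply: lee_pmul => //.
  - by apply: prode_ge0 => i _; apply: integral_ge0 => x _; rewrite lee_fin powR_ge0.
  - by apply: integral_ge0 => x _; rewrite lee_fin powR_ge0.
  - exact: pair_ratio_le1.
have T1 : (T <= 1)%E by exact: pair_ratio_le1.
move: P1 T1; case: P => [P| |]; case: T => [T| |]//; rewrite -!EFinM !lte_fin => _ _.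
by apply: ltr_pM; exact: powR_ge0.
Qed.

End Areas.

(** * Smooth maps *)

Section CkClosure.
Context {R : realType}.
Implicit Types (V W : normedModType R) (k : nat).

(** The first-order expansion at [z] sees only a neighbourhood of [z], so [g] inherits the
    differential of [f]. *)
Lemma near_eq_differentiable V W (f g : V -> W) (z : V) :
  {near z, f =1 g} -> differentiable f z -> differentiable g z.
Proof.
move=> fg df.
have fgz : f z = g z by exact: nbhs_singleton fg.
have cdf : continuous ('d f z) by exact: diff_continuous.
have H : g \o shift z = cst (g z) + 'd f z +o_ 0 id.
  apply/eqaddoP => e e0; have /eqaddoP/(_ e e0) := diff_locally df.
  have fg0 : \forall h \near 0, f (h + z) = g (h + z).
    by move: fg; rewrite (near_shift 0 z) subr0.
  apply: filterS2 fg0 => h /= fgh.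
  by rewrite -[(f \o _ - _) h]/(f (h + z) - (f z + 'd f z h)) fgh fgz.
by apply/diff_locallyP; rewrite (diff_unique cdf H).
Qed.

(** Openness turns agreement on [U] into agreement near each point of [U], which passes to
    directional derivatives and allows the induction. *)
Lemma Ck_ext V W k (U : set V) (f g : V -> W) : open U ->
  (forall z, U z -> f z = g z) -> Ck_on k U f -> Ck_on k U g.
Proof.
move=> oU; elim: k f g => [|k IH] f g fg.
  move=> cf z Uz; have E : {near z, f =1 g}.
    by move/(open_nbhs_nbhs): (conj oU Uz); apply: filterS => y /fg.
  rewrite /prop_for /continuous_at -fg//.
  by apply: cvg_trans (cf z Uz); exact: near_eq_cvg.
have E z : U z -> {near z, f =1 g}.
  by move=> Uz; move/(open_nbhs_nbhs): (conj oU Uz); apply: filterS => y /fg.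
move=> [df Df]; split=> [z Uz|v].
  by apply: near_eq_differentiable (df z Uz); exact: E.
by apply: IH (Df v) => z /E/near_eq_derive.
Qed.

Lemma CkW V W k (U : set V) (f : V -> W) : Ck_on k.+1 U f -> Ck_on k U f.
Proof.
elim: k f => [|k IH] f [df Df]; first by move=> z /df/differentiable_continuous.
by split => // v; apply: IH; exact: Df.
Qed.

Lemma Ck_differentiable V W k (U : set V) (f : V -> W) z :
  Ck_on k.+1 U f -> U z -> differentiable f z.
Proof. by move=> [df _]; exact: df. Qed.

Lemma Ck_cst V W k (U : set V) (c : W) : Ck_on k U (fun=> c).
Proof.
elim: k c => [|k IH] c; first by move=> z _; exact: cvg_cst.
split=> [z _|v]; first exact: differentiable_cst.
have -> : 'D_v (fun=> c) = (fun=> 0 : W) :> (V -> W); last exact: IH.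
by apply/funext => z; rewrite derive_cst.
Qed.

Lemma Ck_linear V W k (U : set V) (f : {linear V -> W}) :
  continuous f -> Ck_on k U f.
Proof.
move=> cf; case: k => [|k]; first by move=> z _; exact: cf.
split=> [z _|v]; first exact: linear_differentiable.
have -> : 'D_v f = (fun=> f v) :> (V -> W); last exact: Ck_cst.
by apply/funext => z; rewrite deriveE ?diff_lin//; exact: linear_differentiable.
Qed.

Lemma Ck_id V k (U : set V) : Ck_on k U (fun z : V => z).
Proof. by apply: (@Ck_linear V V k U idfun) => z; exact: cvg_id. Qed.

Lemma CkD V W k (U : set V) (f g : V -> W) : open U ->
  Ck_on k U f -> Ck_on k U g -> Ck_on k U (fun z => f z + g z).
Proof.
move=> oU; elim: k f g => [|k IH] f g.
  by move=> cf cg z Uz; apply: cvgD; [exact: cf|exact: cg].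
move=> [df Df] [dg Dg]; split=> [z Uz|v].
  by apply: differentiableD; [exact: df|exact: dg].
apply: (@Ck_ext _ _ _ _ (fun z => 'D_v f z + 'D_v g z)) => //.
  move=> z Uz; rewrite -[RHS]/('D_v (f + g) z) deriveD//; apply: diff_derivable; first exact: df.
  exact: dg.
by apply: IH; [exact: Df|exact: Dg].
Qed.

Lemma CkZ V W k (U : set V) (f : V -> R) (w : W) : open U ->
  Ck_on k U f -> Ck_on k U (fun z => f z *: w).
Proof.
move=> oU; elim: k f => [|k IH] f.
  by move=> cf z Uz; apply: cvgZr_tmp; exact: cf.
move=> [df Df].
have dfw z : U z -> is_diff z (fun z => f z *: w) (( *:%R ^~ w) \o 'd f z).
  move=> Uz; have h1 : is_diff z f ('d f z) by split => //; exact: df.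
  have h2 := is_diff_scalel (f z) w.
  exact: (is_diff_comp h1 h2).
split=> [z Uz|v]; first by have [] := dfw z Uz.
apply: (@Ck_ext _ _ _ _ (fun z => 'D_v f z *: w)) => //; last by apply: IH; exact: Df.
move=> z Uz; have [d e] := dfw z Uz; rewrite !deriveE ?e//; exact: df.
Qed.

Lemma CkM V k (U : set V) (f g : V -> R) : open U ->
  Ck_on k U f -> Ck_on k U g -> Ck_on k U (fun z => f z * g z).
Proof.
move=> oU; elim: k f g => [|k IH] f g.
  by move=> cf cg z Uz; apply: cvgM; [exact: cf|exact: cg].
move=> Cf Cg; have [df Df] := Cf; have [dg Dg] := Cg; split=> [z Uz|v].
  by apply: differentiableM; [exact: df|exact: dg].
apply: (@Ck_ext _ _ _ _ (fun z => f z * 'D_v g z + g z * 'D_v f z)) => //.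
  move=> z Uz; rewrite -[RHS]/('D_v (f * g) z) deriveM//; apply: diff_derivable; first exact: df.
  exact: dg.
apply: CkD => //; apply: IH => //; [exact: CkW|exact: Dg|exact: CkW|exact: Df].
Qed.

Lemma Ck_comp V k (U : set V) (I : set R) (f : V -> R) (g : R -> R) : open U ->
  (forall z, U z -> I (f z)) -> Ck_on k I g -> Ck_on k U f ->
  Ck_on k U (fun z => g (f z)).
Proof.
move=> oU UI; elim: k g => [|k IH] g.
  move=> cg cf z Uz; apply: (@continuous_comp _ _ _ f g); first exact: cf.
  by apply: cg; exact: UI.
move=> Cg Cf; have [df Df] := Cf; have [dg Dg] := Cg; split=> [z Uz|v].
  by apply: differentiable_comp; [exact: df|apply: dg; exact: UI].
apply: (@Ck_ext _ _ _ _ (fun z => 'D_1 g (f z) * 'D_v f z)) => //.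
  move=> z Uz; apply/esym; apply: derive_val.
  apply: is_derive_ptcomp; first exact: df.
  by split => //; apply: diff_derivable; apply: dg; exact: UI.
apply: CkM => //; last exact: Df.
by apply: (IH ('D_1 g)); [exact: Dg|exact: CkW].
Qed.

(** The bootstrap step: powers, [sin] and [cos], and later the angle [Th] have derivatives expressed
    through functions already known to be of class [k]. *)
Lemma CkS_R k (I : set R) (g g' : R -> R) : open I ->
  (forall x, I x -> is_derive x 1 g (g' x)) -> Ck_on k I g' -> Ck_on k.+1 I g.
Proof.
move=> oI dg Cg; split=> [x Ix|v].
  by apply/derivable1_diffP; have [] := dg x Ix.
apply: (@Ck_ext _ _ _ _ (fun x => v * g' x)) => //; last first.
  by apply: CkM => //; exact: Ck_cst.
move=> x Ix; have [/derivable1_diffP d <-] := dg x Ix.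
rewrite !deriveE// -[v in RHS]mulr1 -[v * 1 in RHS]/(v *: (1 : R)).
by rewrite linearZ.
Qed.

Lemma Ck_powR k (r : R) : Ck_on k [set x : R | 0 < x] (fun x => x `^ r).
Proof.
have oI : open [set x : R | 0 < x] by exact: open_gt.
elim: k r => [|k IH] r.
  move=> x x0; apply/differentiable_continuous/derivable1_diffP.
  by have [] := is_derive1_powR r x0.
apply: (@CkS_R _ _ _ (fun x => r * x `^ (r - 1))) => //.
by apply: CkM => //; exact: Ck_cst.
Qed.

Lemma Ck_sin_cos k : Ck_on k setT (@sin R) /\ Ck_on k setT (@cos R).
Proof.
elim: k => [|k [IHs IHc]].
  by split=> x _; [exact: continuous_sin|exact: continuous_cos].
split.
  by apply: (@CkS_R _ _ _ cos) => //; exact: openT.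
apply: (@CkS_R _ _ _ (fun x => -1 * sin x)); first exact: openT.
  by move=> x _; rewrite mulN1r; exact: is_derive_cos.
by apply: CkM => //; [exact: openT|exact: Ck_cst].
Qed.

End CkClosure.

(** * An area-preserving map of a planar region into a disc *)

Section AreaCoordinate.
Context {R : realType}.
Notation leb := (@lebesgue_measure R).

Lemma is_derive_continuous (f : R -> R) (x d : R) :
  is_derive x 1 f d -> {for x, continuous f}.
Proof. by case=> h _; apply/differentiable_continuous/derivable1_diffP. Qed.

(* [disc_area th] is, up to a constant, the area of the part of the unit disc
   at the left of [sin th], divided by two. *)
Definition disc_area (th : R) : R := (th + sin th * cos th) / 2.

Lemma is_derive_disc_area (th : R) : is_derive th 1 disc_area (cos th ^+ 2).
Proof.
apply: (is_derive_eq (is_derive_ptM (is_derive_ptD (is_derive_id th 1)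
  (is_derive_ptM (is_derive_sin th) (is_derive_cos th))) (is_derive_ptC 2^-1 th 1))).
by rewrite mulrN -!expr2 sin2cos2; field.
Qed.

(** [disc_area] increases strictly from [-pi/4] to [pi/4] on [[-pi/2, pi/2]]. Its derivative [cos^2]
    vanishes at both ends, whence the open intervals. *)
Lemma disc_area_inverse : exists g : R -> R, forall y : R, - (pi / 4) < y < pi / 4 ->
  - (pi / 2) < g y < pi / 2 /\ is_derive y 1 g (cos (g y) ^- 2).
Proof.
have pi0 : 0 < pi :> R by exact: pi_gt0.
have cQ : continuous disc_area.
  by move=> x; exact: is_derive_continuous (is_derive_disc_area x).
have incQ : {in `[- (pi / 2), pi / 2] &, {homo disc_area : x y / x < y}}.
  apply: (@gtr0_derive1_lt R disc_area (- (pi / 2)) (pi / 2) _ _ true false).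
  - by move=> z _; have [] := is_derive_disc_area z.
  - move=> z; rewrite in_itv /= => zi; rewrite derive1E.
    by have [_ ->] := is_derive_disc_area z; rewrite exprn_gt0// cos_gt0_pihalf.
  - exact: continuous_subspaceT.
have Qe : disc_area (pi / 2) = pi / 4.
  by rewrite /disc_area cos_pihalf mulr0 addr0; field.
have QNe : disc_area (- (pi / 2)) = - (pi / 4).
  by rewrite /disc_area cosN cos_pihalf mulr0 addr0; field.
have surj (y : R) : exists th : R, - (pi / 4) < y < pi / 4 ->
    - (pi / 2) < th < pi / 2 /\ disc_area th = y.
  case: (boolP (- (pi / 4) < y < pi / 4)) => [/andP[y1 y2]|_]; last by exists 0.
  have [|||th thi thE] := @IVT R disc_area (- (pi / 2)) (pi / 2) y.
  - by lra.
  - exact: continuous_subspaceT.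
  - by rewrite Qe QNe min_l ?max_r; lra.
  exists th => _; split => //; move: thi; rewrite in_itv /= => /andP[a b].
  by apply/andP; split; rewrite lt_neqAle ?a ?b andbT; apply/eqP => E;
    move: y1 y2; rewrite -thE; [rewrite -E QNe|rewrite E Qe]; rewrite ltxx.
have [g gE] := choice surj.
exists g => y yi; have [gyi Qg] := gE y yi; split=> //.
rewrite -{1}Qg; apply: is_derive_inverse.
- near=> z.
  have zi : - (pi / 2) < z < pi / 2.
    apply/andP; split; near: z; [apply: lt_nbhsr|apply: lt_nbhsl]; by case/andP: gyi.
  have zi' : z \in `[- (pi / 2), pi / 2] by rewrite in_itv /=; case/andP: zi; lra.
  have Qzi : - (pi / 4) < disc_area z < pi / 4.
    by rewrite -QNe -Qe !incQ//; case/andP: zi; rewrite ?in_itv /=; lra.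
  have [gi Qgz] := gE _ Qzi.
  have gi' : g (disc_area z) \in `[- (pi / 2), pi / 2] by rewrite in_itv /=; case/andP: gi; lra.
  have [h|h|//] := ltgtP (g (disc_area z)) z.
    by have := incQ _ _ gi' zi' h; rewrite Qgz ltxx.
  by have := incQ _ _ zi' gi' h; rewrite Qgz ltxx.
- by near=> z; exact: cQ.
- exact: is_derive_disc_area.
- by rewrite gt_eqF// exprn_gt0// cos_gt0_pihalf.
Unshelve. all: by end_near. Qed.

(** Up to a constant, [r^2 disc_area (Th x)] is the integral of [h] up to [x], and differentiating
    gives the stated derivative. The bound is half the area of the disc because [h] is the
    half-height of the region. *)
Lemma area_coordinate (a r : R) (h : R -> R) : 0 < r -> continuous h ->
  (forall x, 0 <= h x) -> \int[leb]_(t in `[- a, a]) h t < pi * r ^+ 2 / 2 ->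
  exists Th : R -> R, forall x, - a < x < a ->
    - (pi / 2) < Th x < pi / 2 /\ is_derive x 1 Th (h x / (r ^+ 2 * cos (Th x) ^+ 2)).
Proof.
move=> r0 ch h0; set T := \int[leb]_(t in `[- a, a]) h t => Tlt.
have [g gP] := disc_area_inverse.
have r20 : 0 < r ^+ 2 by exact: exprn_gt0.
pose H := fun x => \int[leb]_(t in `[- a, x]) h t.
(* Half of the spare area is placed at the left, so that [u] stays strictly inside the domain of [g]
   near both ends. *)
pose e := (pi * r ^+ 2 / 2 - T) / 2.
have e0 : 0 < e by rewrite /e; lra.
have Te : T + e < pi * r ^+ 2 / 2 by rewrite /e; lra.
pose u := fun x : R => (H x + e) * r ^- 2 - pi / 4.
exists (fun x => g (u x)) => x /andP[ax xa].
have HT : T = H x + \int[leb]_(t in `[x, a]) h t by apply: Rintegral_itvD => //; exact: ltW.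
have Hx0 : 0 <= H x by apply: Rintegral_ge0 => t _.
have Rx0 : 0 <= \int[leb]_(t in `[x, a]) h t by apply: Rintegral_ge0 => t _.
have ux : - (pi / 4) < u x < pi / 4.
  apply/andP; split.
    by rewrite /u -[ltLHS]add0r ltrD2r mulr_gt0 ?invr_gt0// ltr_wpDl.
  have HTe : H x + e <= T + e by rewrite lerD2r HT lerDl.
  rewrite /u ltrBlDr ltr_pdivrMr//; apply: (le_lt_trans HTe); apply: (lt_le_trans Te).
  by rewrite le_eqVlt; apply/orP; left; apply/eqP; field.
have [gi dg] := gP _ ux; split => //.
have dH : is_derive x 1 H (h x) by exact: is_derive_parameterized_integral.
have du : is_derive x 1 u (h x * r ^- 2).
  apply: (is_derive_eq (is_derive_ptB (is_derive_ptM (is_derive_ptD dH (is_derive_ptC e x 1))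
    (is_derive_ptC (r ^- 2) x 1)) (is_derive_ptC (pi / 4) x 1))).
  by ring.
apply: (is_derive_eq (is_derive_pt1comp dg du)).
by rewrite [in RHS]invfM [LHS]mulrC -mulrA.
Qed.

Lemma Ck_inv k (I : set R) (f : R -> R) : open I -> (forall x, I x -> 0 < f x) ->
  Ck_on k I f -> Ck_on k I (fun x => (f x)^-1).
Proof.
move=> oI f0 Cf.
apply: (@Ck_ext _ _ _ _ _ (fun x => f x `^ (- 1))) => //.
  by move=> x Ix; rewrite powR_inv1// ltW// f0.
by apply: (@Ck_comp _ _ _ _ [set x | 0 < x] f (fun y => y `^ (- 1))) => //; exact: Ck_powR.
Qed.

(** The planar map is [(x, y) -> (G x, m x * y)], and [Gi] inverts [G] on its image. Continuity of
    [G'] and [Gi] is what continuity of the inverse map will require. *)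
Lemma planar_coordinate (a r : R) (h : R -> R) (I := [set x : R | - a < x < a]) :
  0 < r -> continuous h -> (forall x, 0 <= h x) -> (forall x, I x -> 0 < h x) ->
  (forall k, Ck_on k I h) ->
  \int[leb]_(t in `[- a, a]) h t < pi * r ^+ 2 / 2 ->
  exists G G' m Gi : R -> R, [/\ (forall k, Ck_on k I G), (forall k, Ck_on k I m) &
    forall x, I x -> [/\ is_derive x 1 G (G' x), {for x, continuous G'}, m x * G' x = 1,
      Gi (G x) = x /\ {for G x, continuous Gi} &
      forall y, `|y| < h x -> G x ^+ 2 + (m x * y) ^+ 2 < r ^+ 2]].
Proof.
move=> r0 ch h0 hI Ch Tlt.
have oI : open I.
  rewrite (_ : I = `]- a, a[%classic); first exact: interval_open.
  by apply/seteqP; split => x; rewrite /= in_itv.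
have r20 : 0 < r ^+ 2 by exact: exprn_gt0.
have [Th ThP] := area_coordinate r0 ch h0 Tlt.
have cos0 x : I x -> 0 < cos (Th x).
  by move=> /ThP[? _]; exact: cos_gt0_pihalf.
have den0 x : I x -> 0 < r ^+ 2 * cos (Th x) ^+ 2.
  by move=> Ix; rewrite mulr_gt0// exprn_gt0// cos0.
(* [Th] solves [Th' = h / (r cos Th)^2]: class [k] for [Th] gives class [k] for the right-hand side,
   hence class [k + 1] for [Th]. *)
have CTh k : Ck_on k I Th.
  elim: k => [|k IH].
    by move=> x /ThP[_ d]; exact: is_derive_continuous d.
  apply: (@CkS_R _ _ _ _ (fun x => h x / (r ^+ 2 * cos (Th x) ^+ 2))) => //.
    by move=> x /ThP[].
  have Cc : Ck_on k I (fun x => cos (Th x)).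
    by apply: (@Ck_comp _ _ _ _ setT Th cos) => //; have [] := @Ck_sin_cos R k.
  apply: CkM => //; apply: Ck_inv => //; apply: CkM => //; first exact: Ck_cst.
  exact: CkM.
have Csin k : Ck_on k I (fun x => sin (Th x)).
  by apply: (@Ck_comp _ _ _ _ setT Th sin) => //; have [] := @Ck_sin_cos R k.
have Ccos k : Ck_on k I (fun x => cos (Th x)).
  by apply: (@Ck_comp _ _ _ _ setT Th cos) => //; have [] := @Ck_sin_cos R k.
pose G := fun x => r * sin (Th x).
pose G' := fun x => h x / (r * cos (Th x)).
(* [m] is the reciprocal of [G'], which makes the map area-preserving. *)
pose m := fun x => r * cos (Th x) / h x.
have dG x : I x -> is_derive x 1 G (G' x).
  move=> Ix; have [_ dT] := ThP x Ix.
  apply: (is_derive_eq (is_derive_ptM (is_derive_ptC r x 1)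
    (is_derive_pt1comp (is_derive_sin (Th x)) dT))).
  by rewrite /G'; field; rewrite !gt_eqF//= cos0.
have G'0 x : I x -> 0 < G' x.
  by move=> Ix; rewrite divr_gt0// ?mulr_gt0 ?hI// cos0.
have CG' k : Ck_on k I G'.
  apply: CkM => //; apply: Ck_inv => //; first by move=> x Ix; rewrite mulr_gt0// cos0.
  by apply: CkM => //; exact: Ck_cst.
have Ginj x y : I x -> I y -> G x = G y -> x = y.
  suff lt u v : I u -> I v -> u < v -> G u < G v.
    move=> Ix Iy Gxy; have [h1|h1|//] := ltgtP x y.
      by have := lt _ _ Ix Iy h1; rewrite Gxy ltxx.
    by have := lt _ _ Iy Ix h1; rewrite Gxy ltxx.
  move=> /andP[au ua] /andP[av va] uv.
  have sub z : u <= z <= v -> I z by move=> /andP[uz zv]; rewrite /I /=; lra.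
  have := @gtr0_derive1_lt R G u v _ _ true false _ u v.
  rewrite !in_itv /= !lexx ltW//; apply => //.
  - by move=> z; rewrite in_itv /= => zi; have [] := dG z _; first by apply: sub; lra.
  - move=> z; rewrite in_itv /= derive1E => zi.
    have Iz : I z by apply: sub; lra.
    by have [_ ->] := dG z Iz; exact: G'0.
  - apply: continuous_in_subspaceT => z; rewrite inE /= in_itv /= => zi.
    exact: is_derive_continuous (dG z (sub z zi)).
(* Off the image of [G] the choice is arbitrary; [Gi] is examined only at points [G x], around which
   the image contains a neighbourhood. *)
have [Gi GiP] : exists Gi : R -> R, forall x, I x -> Gi (G x) = x.
  have ex X : exists x, (exists2 y, I y & G y = X) -> I x /\ G x = X.
    have [[y Iy yX]|nX] := pselect (exists2 y, I y & G y = X).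
      by exists y => _.
    by exists 0 => /nX.
  have [Gi GiE] := choice ex; exists Gi => x Ix.
  have [IG GG] := GiE (G x) (ex_intro2 _ _ x Ix erefl).
  exact: Ginj.
exists G, G', m, Gi; split.
- by move=> k; apply: CkM => //; exact: Ck_cst.
- move=> k; apply: CkM => //; last exact: Ck_inv.
  by apply: CkM => //; exact: Ck_cst.
move=> x Ix; have nbI : \forall y \near x, I y by exact: open_nbhs_nbhs.
split.
- exact: dG.
- exact: (CG' 0 x Ix).
- by rewrite /m /G'; field; rewrite !gt_eqF ?hI// cos0.
- split; first exact: GiP.
  apply: (is_derive_continuous (d := (G' x)^-1)); apply: (@is_derive_inverse _ G Gi); last first.
  + by rewrite gt_eqF// G'0.
  + exact: dG.
  + by apply: filterS nbI => y Iy; exact: is_derive_continuous (dG y Iy).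
  + by apply: filterS nbI => y Iy; exact: GiP.
- move=> y yh.
  have t1 : (y / h x) ^+ 2 < 1.
    rewrite -real_normK ?num_real// normrM normfV (gtr0_norm (hI x Ix)).
    by rewrite expr_lt1 ?divr_ge0// ltr_pdivrMr ?mul1r// hI.
  have -> : G x ^+ 2 + (m x * y) ^+ 2 =
      r ^+ 2 * (sin (Th x) ^+ 2 + cos (Th x) ^+ 2 * (y / h x) ^+ 2).
    by rewrite /G /m; ring.
  rewrite -[ltRHS]mulr1 ltr_pM2l// -(cos2Dsin2 (Th x)) addrC ltrD2r.
  by rewrite -[ltRHS]mulr1 ltr_pM2l// exprn_gt0// cos0.
Qed.

End AreaCoordinate.

(** * Symplectic maps that alter a single coordinate pair *)

Section Coordinates.
Context {R : realType} {N : nat}.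
Implicit Types (i : 'I_N) (z : 'rV[R]_N).

Lemma coord_linear i : linear (fun z => z 0 i : R).
Proof. by move=> a u v; rewrite !mxE. Qed.

Definition coord i : {linear 'rV[R]_N -> R} :=
  HB.pack (fun z => z 0 i) (GRing.isLinear.Build _ _ _ _ _ (coord_linear i)).

Lemma continuous_coord i : continuous (coord i).
Proof. exact: coord_continuous. Qed.

Lemma Ck_coord k (U : set 'rV[R]_N) i : Ck_on k U (fun z => z 0 i).
Proof. by apply: (Ck_linear _ _ (f := coord i)); exact: continuous_coord. Qed.

Lemma is_derive_coord i z u : is_derive z u (fun z => z 0 i) (u 0 i).
Proof.
have d : differentiable (coord i) z by apply: linear_differentiable; exact: continuous_coord.
split; first exact: diff_derivable.
rewrite -[LHS]/('D_u (coord i) z) (deriveE u d) diff_lin//.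
exact: continuous_coord.
Qed.

End Coordinates.

Lemma continuous_shear {R : realType} (V : normedModType R)
    (f g : V -> R) (v w x : V) :
  {for x, continuous f} -> {for x, continuous g} ->
  {for x, continuous (fun z => z + (f z *: v + g z *: w))}.
Proof.
move=> cf cg; apply: cvgD; first exact: cvg_id.
by apply: cvgD; apply: cvgZr_tmp.
Qed.

Section CylinderEmbedding.
Context {R : realType} {n : nat} (i0 : 'I_n).
Notation V := 'rV[R]_(n + n).
Notation cx z := (z 0%R (lshift n i0)).
Notation cy z := (z 0%R (rshift n i0)).
Notation ex := (delta_mx 0 (lshift n i0) : V).
Notation ey := (delta_mx 0 (rshift n i0) : V).

Lemma is_derive_scalel (f : V -> R) (w z u : V) (df : R) : differentiable f z ->
  is_derive z u f df -> is_derive z u (fun z => f z *: w) (df *: w).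
Proof.
move=> dfz [_ <-]; have h1 : is_diff z f ('d f z) by split.
have h2 := is_diff_scalel (f z) w.
have [d e] := is_diff_comp h1 h2.
split; first exact: diff_derivable.
by rewrite (deriveE u d) e /= deriveE.
Qed.

(** Replaces the pair [(cx z, cy z)] by [(g z, k z)]. The form [z] plus a correction reduces
    smoothness to that of two scalar functions. *)
Let shx (g : V -> R) (k : V -> R) (z : V) : V :=
  z + ((g z - cx z) *: ex + (k z - cy z) *: ey).

Let cx_shx g k z : cx (shx g k z) = g z.
Proof.
by rewrite /shx !mxE !eqxx /= eq_lrshift mulr1 mulr0 addr0 addrC subrK.
Qed.

Let cy_shx g k z : cy (shx g k z) = k z.
Proof.
by rewrite /shx !mxE !eqxx /= eq_rlshift mulr1 mulr0 add0r addrC subrK.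
Qed.

(** The map acts in one symplectic plane and fixes the other coordinates, so preserving [omega]
    means having determinant 1 in that plane. The cylinder leaves the other coordinates free, so
    only the projection of [K] to the plane matters. *)
Lemma embeds_cylinder (I : set R) (h G G' m Gi : R -> R) (r : R) (K : set V) :
  nat_of_ord i0 = 0%N -> 0 < r -> open I -> 
  (forall k, Ck_on k I G) -> (forall k, Ck_on k I m) ->
  (forall x, I x -> [/\ is_derive x 1 G (G' x), {for x, continuous G'}, m x * G' x = 1,
      Gi (G x) = x /\ {for G x, continuous Gi} &
      forall y, `|y| < h x -> G x ^+ 2 + (m x * y) ^+ 2 < r ^+ 2]) ->
  (forall z, K z -> I (cx z) /\ `|cy z| < h (cx z)) ->
  embeds_symplectically K [set r *: z | z in @unit_cylinder R n].
Proof.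
move=> i00 r0 oI CG Cm P KP.
pose U := [set z : V | I (cx z)].
have oU : open U by apply: open_comp => // z _; exact: coord_continuous.
pose g := fun z : V => G (cx z).
pose k := fun z : V => m (cx z) * cy z.
pose phi := shx g k.
(* Dividing by [m] is multiplying by [G'], taken at the recovered abscissa. *)
pose psi := shx (fun z => Gi (cx z)) (fun z => cy z * G' (Gi (cx z))).
have Cg j : Ck_on j U g by apply: (@Ck_comp R V j U I (fun z : V => cx z) G) => //; exact: Ck_coord.
have Cmx j : Ck_on j U (fun z => m (cx z)).
  by apply: (@Ck_comp R V j U I (fun z : V => cx z) m) => //; exact: Ck_coord.
have Ck' j : Ck_on j U k by apply: CkM => //; exact: Ck_coord.
have CB j (f f' : V -> R) : Ck_on j U f -> Ck_on j U f' -> Ck_on j U (fun z => f z - f' z).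
  move=> Cf Cf'; apply: CkD => //; apply: (@Ck_ext _ _ _ _ _ (fun z => -1 * f' z)) => //.
    by move=> z _; rewrite mulN1r.
  by apply: CkM => //; exact: Ck_cst.
have Cphi j : Ck_on j U phi.
  apply: CkD => //; first exact: Ck_id.
  by apply: CkD => //; apply: CkZ => //; apply: CB => //; exact: Ck_coord.
exists U, phi; split.
- by move=> z /KP[].
- split => //; last first.
  + move=> z Uz u v; have [dG _ mG _ _] := P _ Uz.
    have dcx w : differentiable (fun z : V => z 0 w) z.
      by apply: (linear_differentiable (f := coord w)); exact: continuous_coord.
    pose N := 'D_1 m (cx z).
    have dm : is_derive (cx z) 1 m N.
      by split => //; apply: diff_derivable; exact: (Ck_differentiable (Cm 1%N)).
    have dphi w : 'd phi z w = shx (fun w => G' (cx z) * cx w)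
        (fun w => m (cx z) * cy w + cy z * (N * cx w)) w.
      rewrite -deriveE; last exact: (Ck_differentiable (Cphi 1%N)).
      have cxD : is_derive z w (fun z : V => cx z) (cx w) by exact: is_derive_coord.
      have cyD : is_derive z w (fun z : V => cy z) (cy w) by exact: is_derive_coord.
      have gD : is_derive z w g (G' (cx z) * cx w).
        have := is_derive_ptcomp w (dcx (lshift n i0)) dG.
        by have [_ ->] := cxD.
      have kD : is_derive z w k (m (cx z) * cy w + cy z * (N * cx w)).
        have := is_derive_ptcomp w (dcx (lshift n i0)) dm.
        have [_ ->] := cxD => mD; exact: (is_derive_ptM mD cyD).
      have dg : differentiable (fun z => g z - cx z) z.
        by apply: differentiableB => //; exact: (Ck_differentiable (Cg 1%N)).
      have dk : differentiable (fun z => k z - cy z) z.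
        by apply: differentiableB => //; exact: (Ck_differentiable (Ck' 1%N)).
      have D1 := is_derive_scalel ex dg (is_derive_ptB gD cxD).
      have D2 := is_derive_scalel ey dk (is_derive_ptB kD cyD).
      by have [_ ->] := is_deriveD (is_derive_id z w) (is_deriveD D1 D2).
    rewrite !dphi /omega; apply: eq_bigr => j _.
    have [->|ji] := eqVneq j i0.
      rewrite !cx_shx !cy_shx.
      (* The planar differential is triangular: the terms in [N] cancel and its determinant is
         [m G' = 1]. *)
      transitivity ((m (cx z) * G' (cx z)) * (cx u * cy v - cy u * cx v)); first by ring.
      by rewrite mG mul1r.
    rewrite !mxE !eqxx /= !eq_lrshift !eq_rlshift (inj_eq (@lshift_inj _ _)) (inj_eq (@rshift_inj _ _)).
    by rewrite (negbTE ji) /= !mulr0 !addr0.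
  + exists psi => [z Uz|].
      have [_ _ mG [GiG _] _] := P _ Uz.
      rewrite /psi /shx -/phi !cx_shx !cy_shx /g GiG /k.
      rewrite mulrAC mG mul1r /phi /shx /g /k.
      apply/rowP => j; rewrite !mxE; ring.
    apply: continuous_in_subspaceT => _ /set_mem[z Uz <-].
    have [_ cG' _ [GiG cGi] _] := P _ Uz.
    have cxc : {for phi z, continuous (fun z : V => cx z)} by exact: coord_continuous.
    have cyc : {for phi z, continuous (fun z : V => cy z)} by exact: coord_continuous.
    have cxphi : cx (phi z) = G (cx z) by rewrite cx_shx.
    have c1 : {for phi z, continuous (fun z : V => Gi (cx z))}.
      by apply: (@continuous_comp _ _ _ (fun z : V => cx z) Gi) => //; rewrite cxphi.
    have c2 : {for phi z, continuous (fun z : V => cy z * G' (Gi (cx z)))}.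
      have c3 : {for phi z, continuous (fun z : V => G' (Gi (cx z)))}.
        apply: (@continuous_comp _ _ _ (fun z : V => Gi (cx z)) G') => //.
        by rewrite cxphi GiG.
      exact: (continuousM cyc c3).
    apply: (@continuous_shear _ V (fun w => Gi (cx w) - cx w)
        (fun w => cy w * G' (Gi (cx w)) - cy w) ex ey).
      exact: (continuousB c1 cxc).
    exact: (continuousB c2 cyc).
- move=> _ [z Kz <-]; have [Ix yh] := KP z Kz; have [_ _ _ _ /(_ _ yh) lt] := P _ Ix.
  exists (r^-1 *: phi z); last by rewrite scalerA divff ?scale1r// gt_eqF.
  move=> i ii; have -> : i = i0 by apply: val_inj; rewrite /= ii i00.
  have cZ c (w : V) j : (c *: w) 0 j = c * w 0 j by rewrite mxE.
  rewrite !cZ cx_shx cy_shx ![(r^-1 * _) ^+ 2]exprMn -mulrDr exprVn.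
  by rewrite mulrC ltr_pdivrMr ?mul1r// exprn_gt0.
Qed.

End CylinderEmbedding.

(** * A region with smooth profile slightly larger than the superellipse *)

Section Superellipse.
Context {R : realType}.
Notation leb := (@lebesgue_measure R).

(* Convexity of [t `^ q] along [x + e = (1 + e) (x / (1 + e) + e / (1 + e))]. *)
Lemma powR_addr_le (q x e : R) : 1 < q -> 0 <= x -> 0 < e ->
  (x + e) `^ q <= (1 + e) `^ (q - 1) * (x `^ q + e).
Proof.
move=> q1 x0 e0; have q0 : 0 < q by lra.
have e1 : 0 < 1 + e by lra.
have l0 : 0 <= (1 + e)^-1 by rewrite invr_ge0 ltW.
have l1 : (1 + e)^-1 <= 1 by rewrite invf_le1//; lra.
have h : ((1 + e)^-1 * x + (1 - (1 + e)^-1) * 1) `^ q <=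
    (1 + e)^-1 * x `^ q + (1 - (1 + e)^-1) * 1 `^ q.
  by apply: (convex_powR (ltW q1) (Itv01 l0 l1)); rewrite inE /= in_itv /= andbT.
rewrite one_powR !mulr1 in h.
rewrite (_ : x + e = (1 + e) * ((1 + e)^-1 * x + (1 - (1 + e)^-1))); last by field; rewrite gt_eqF.
have y0 : 0 <= (1 + e)^-1 * x + (1 - (1 + e)^-1).
  by rewrite addr_ge0 ?mulr_ge0// subr_ge0.
rewrite (powRM q (ltW e1) y0) -(mulr_powRB1 (ltW e1) q0) [(1 + e) * _]mulrC -mulrA.
rewrite ler_wpM2l ?powR_ge0// -ler_pdivlMl//; apply: (le_trans h).
by rewrite le_eqVlt; apply/orP; left; apply/eqP; field; rewrite gt_eqF.
Qed.

(** Since [|x|^p] need not be smooth at 0, it is replaced by [(x^2 + eta)^(p/2)], and the level 1 by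
    a slightly larger [c] that makes room for the closed superellipse in the open region. *)
Lemma superellipse_profile (p kap A r : R) : 2 < p -> 0 < kap -> 0 < A ->
  lebesgue_tuple (@lp_body R p 2 1) = A%:E -> kap * A < pi * r ^+ 2 ->
  exists (a : R) (h : R -> R), let I := [set x : R | - a < x < a] in
  [/\ continuous h, (forall x, 0 <= h x) /\ (forall x, I x -> 0 < h x),
    (forall k, Ck_on k I h), \int[leb]_(t in `[- a, a]) h t < pi * r ^+ 2 / 2 &
    forall x y : R, `|x| `^ p + (`|y| / kap) `^ p <= 1 -> I x /\ `|y| < h x].
Proof.
move=> p2 kap0 A0 AE Ar.
have p0 : 0 < p by lra.
have kA0 : 0 < kap * A by exact: mulr_gt0.
(* Chosen so that [kap * A * (1 + 2 * eta)] is the midpoint of [kap * A] and [pi * r^2]. *)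
pose eta := (pi * r ^+ 2 - kap * A) / (4 * (kap * A)).
have eta0 : 0 < eta by rewrite divr_gt0 ?mulr_gt0//; lra.
have eta_lt : kap * A * (1 + 2 * eta) < pi * r ^+ 2.
  have -> : kap * A * (1 + 2 * eta) = kap * A + (pi * r ^+ 2 - kap * A) / 2.
    by rewrite /eta; field; rewrite !gt_eqF.
  by lra.
clearbody eta.
pose q := p / 2.
have q1 : 1 < q by rewrite /q ltr_pdivlMr// mul1r.
have q0 : 0 < q by lra.
(* Raising the level from 1 to [c] multiplies planar areas by [c^(2/p) = 1 + 2 eta]. *)
pose c := (1 + 2 * eta) `^ q.
have c0 : 0 < c by rewrite powR_gt0//; lra.
pose f := fun x : R => x * x + eta.
have f0 x : 0 < f x by rewrite ltr_wpDl// -expr2 sqr_ge0.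
pose w := fun x => c - pos_powR q (f x).
have wE x : w x = c - f x `^ q by rewrite /w pos_powRE// ltW.
pose h := fun x => kap * pos_powR p^-1 (w x).
(* [w] vanishes where [x^2 + eta = 1 + 2 eta]. *)
pose a := Num.sqrt (1 + eta).
have a2 : a ^+ 2 = 1 + eta by rewrite sqr_sqrtr//; lra.
have a0 : 0 < a by rewrite sqrtr_gt0; lra.
have ltaE x : (- a < x < a) = (x ^+ 2 < 1 + eta).
  rewrite -ltr_norml -a2 -[x ^+ 2]real_normK ?num_real//.
  by rewrite ltr_pXn2r// nnegrE ltW.
have absE x : `|x| `^ p = (x ^+ 2) `^ q.
  rewrite -[x ^+ 2]real_normK ?num_real// -powR_mulrn// -powRrM /q.
  by rewrite mulrCA divff// mulr1.
have w0 x : - a < x < a -> 0 < w x.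
  rewrite ltaE wE subr_gt0 => xa; apply: gt0_ltr_powR => //; rewrite ?nnegrE.
  - exact: ltW.
  - by lra.
  - by rewrite /f -expr2; lra.
have h0 x : 0 <= h x by rewrite mulr_ge0 ?pos_powR_ge0// ltW.
have hI x : - a < x < a -> 0 < h x.
  by move=> xa; rewrite mulr_gt0// /pos_powR max_l ?powR_gt0// ?w0// ltW// w0.
have cf : continuous f.
  by move=> x; apply: cvgD; [apply: cvgM; exact: cvg_id|exact: cvg_cst].
have cw : continuous w.
  move=> x; apply: cvgB; first exact: cvg_cst.
  by apply: (@continuous_comp _ _ _ f (pos_powR q)); [exact: cf|exact: continuous_pos_powR].
have ch : continuous h.
  move=> x; apply: cvgM; first exact: cvg_cst.
  apply: (@continuous_comp _ _ _ w (pos_powR p^-1)); first exact: cw.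
  by apply: continuous_pos_powR; rewrite invr_gt0.
exists a, h; split => //.
- move=> k; set I := [set x | _].
  have oI : open I.
    rewrite (_ : I = `]- a, a[%classic); first exact: interval_open.
    by apply/seteqP; split => x; rewrite /= in_itv.
  have Cf : Ck_on k I f.
    by apply: CkD => //; [apply: CkM => //; exact: Ck_id|exact: Ck_cst].
  have Cfq : Ck_on k I (fun x => f x `^ q).
    apply: (@Ck_comp _ _ _ _ [set x | 0 < x] f (fun y => y `^ q)) => //.
      by move=> z _; exact: f0.
    exact: Ck_powR.
  have Cw : Ck_on k I w.
    apply: (@Ck_ext _ _ _ _ _ (fun x => c + (-1) * f x `^ q)) => //.
      by move=> x _; rewrite wE mulN1r.
    apply: CkD => //; first exact: Ck_cst.
    by apply: CkM => //; exact: Ck_cst.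
  apply: CkM => //; first exact: Ck_cst.
  apply: (@Ck_ext _ _ _ _ _ (fun x => w x `^ p^-1)) => //.
    by move=> x /w0 wx; rewrite pos_powRE// ltW.
  apply: (@Ck_comp _ _ _ _ [set x | 0 < x] w (fun y => y `^ p^-1)) => //.
  exact: Ck_powR.
- have iF : leb.-integrable `[- a, a] (EFin \o h).
    apply: continuous_compact_integrable; first exact: segment_compact.
    exact: continuous_subspaceT.
  (* As [f x >= x^2], [h] is at most [kap (c - |x|^p)^(1/p)], whose integral is half the area of the
     level [c] superellipse stretched by [kap]. *)
  have le1 : (\int[leb]_(x in `[(- a)%R, a]) (h x)%:E <= (kap / 2 * ((1 + 2 * eta) * A))%:E)%E.
    have -> : ((kap / 2 * ((1 + 2 * eta) * A))%:E =
        (kap / 2)%:E * lebesgue_tuple (@lp_body R p 2 c))%E.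
      rewrite lebesgue_lp_body ?ltW// AE /c -powRrM /q.
      rewrite (_ : p / 2 * (2%:R / p) = 1); last by field; rewrite gt_eqF.
      by rewrite powRr1//; lra.
    rewrite lebesgue_lp_body2//.
    pose D : set (measurableTypeR R) := [set x | (`|x| `^ p <= c)%R].
    rewrite -/D.
    have mD : measurable D.
      rewrite -[X in measurable X]setTI.
      by apply: measurable_fun_le => //; exact: measurable_powR_abs.
    have mF : measurable_fun setT (fun x : measurableTypeR R => ((c - `|x| `^ p) `^ p^-1)%R : measurableTypeR R).
      apply: (measurableT_comp (measurable_powR _)) => //.
      by apply: measurable_funB => //; exact: measurable_powR_abs.
    rewrite -ge0_integralZl//; last 3 first.
    + apply/measurable_EFinP; apply: measurable_funM => //.
      exact: measurable_funTS mF.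
    + by move=> x _; rewrite lee_fin mulr_ge0// powR_ge0.
    + by rewrite lee_fin; lra.
    have sub : `[- a, a]%classic `<=` D.
      move=> x; rewrite /= in_itv /= -ler_norml => xa.
      have xa2 : x ^+ 2 <= 1 + eta.
        by rewrite -a2 -[x ^+ 2]real_normK ?num_real// ler_pXn2r ?nnegrE ?(ltW a0).
      rewrite /D /= absE; apply: ge0_ler_powR; rewrite ?nnegrE ?sqr_ge0 ?(ltW q0)//.
        by lra.
      by lra.
    apply: (@le_trans _ _ (\int[leb]_(x in `[(- a)%R, a]) ((kap / 2)%:E * (2 * (c - `|x| `^ p) `^ p^-1)%:E))%E).
      apply: ge0_le_integral => //.
      * by move=> x _; rewrite lee_fin.
      * exact: measurable_int iF.
      * apply/measurable_EFinP; apply: measurable_funM => //; apply: measurable_funM => //.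
        exact: measurable_funTS mF.
      * move=> x /sub xD; rewrite -EFinM lee_fin mulrA divfK//.
        rewrite /h ler_pM2l// /pos_powR; apply: ge0_ler_powR.
        - by rewrite invr_ge0 ltW.
        - by rewrite nnegrE le_max lexx orbT.
        - by rewrite nnegrE subr_ge0.
        - rewrite ge_max subr_ge0 xD andbT wE lerD2l lerN2 absE.
          apply: ge0_ler_powR; rewrite ?nnegrE ?sqr_ge0 ?(ltW q0) ?(ltW (f0 x))//.
          by rewrite /f -expr2 lerDl ltW.
    apply: ge0_subset_integral => //.
    + apply/measurable_EFinP; apply: measurable_funM => //; apply: measurable_funM => //.
      exact: measurable_funTS mF.
    + by move=> x _; rewrite -EFinM lee_fin !mulr_ge0 ?powR_ge0// ltW.
  have fin : (\int[leb]_(x in `[(- a)%R, a]) (h x)%:E)%E \is a fin_num.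
    exact: integrable_fin_num iF.
  have le2 : \int[leb]_(t in `[- a, a]) h t <= kap / 2 * ((1 + 2 * eta) * A).
    by rewrite -lee_fin /Rintegral fineK.
  apply: (le_lt_trans le2).
  rewrite (_ : kap / 2 * _ = kap * A * (1 + 2 * eta) / 2); last by field.
  by rewrite ltr_pM2r.
- move=> x y xy.
  have x2 : 0 <= x ^+ 2 by exact: sqr_ge0.
  pose M := (1 + eta) `^ (q - 1).
  have e1 : 0 < 1 + eta by lra.
  have M1 : 1 <= M.
    rewrite -[leLHS](one_powR (q - 1)); apply: ge0_ler_powR; rewrite ?nnegrE; lra.
  have MqE : M * (1 + eta) = (1 + eta) `^ q.
    by rewrite mulrC mulr_powRB1// ltW.
  have key : f x `^ q <= M * (`|x| `^ p + eta).
    rewrite absE /f -expr2; exact: powR_addr_le.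
  (* With [X = |x|^p] and [Y = (|y| / kap)^p], the bounds [Y <= 1 - X] and [M >= 1] give [f x ^ q +
     Y <= M (X + eta) + M (1 - X) = M (1 + eta) < c]. *)
  have fw : (`|y| / kap) `^ p < w x.
    have Mc : M * (1 + eta) < c.
      by rewrite MqE; apply: gt0_ltr_powR; rewrite ?nnegrE; lra.
    have X1 : `|x| `^ p <= 1 by apply: le_trans xy; rewrite lerDl powR_ge0.
    have X0 : 0 <= `|x| `^ p by exact: powR_ge0.
    rewrite wE; move: key xy Mc X1 X0 M1.
    move: (`|x| `^ p) ((`|y| / kap) `^ p) (f x `^ q) => X Y F; nra.
  have wx0 : 0 < w x by apply: le_lt_trans fw; exact: powR_ge0.
  split.
    rewrite /= ltaE ltNge; apply/negP => xa.
    move: wx0; rewrite wE subr_gt0 ltNge => /negP; apply.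
    apply: ge0_ler_powR; rewrite ?nnegrE ?(ltW q0) ?(ltW (f0 x))//; rewrite /f -?expr2; lra.
  rewrite /h mulrC -ltr_pdivrMr// pos_powRE; last exact: ltW.
  have yk0 : 0 <= `|y| / kap by rewrite divr_ge0// ltW.
  rewrite -[ltLHS](powRr1 yk0) -(mulfV (lt0r_neq0 p0)) powRrM.
  by apply: gt0_ltr_powR; rewrite ?invr_gt0 ?nnegrE ?powR_ge0 ?(ltW wx0).
Qed.

End Superellipse.

(** * Capacities *)

Section LinearEmbedding.
Context {R : realType} {n : nat}.
Notation V := 'rV[R]_(n + n).
Implicit Types (U W : set V) (Q : 'M[R]_(n + n)).

Lemma Ck_mulmx k U Q : open U -> Ck_on k U (fun z : V => z *m Q).
Proof.
move=> oU.
apply: (@Ck_ext _ _ _ _ _ (fun z : V => \sum_i z 0 i *: row i Q)) => //.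
  by move=> z _; rewrite mulmx_sum_row.
elim: (index_enum _) => [|i s IH].
  apply: (@Ck_ext _ _ _ _ _ (fun=> 0)) => //; last exact: Ck_cst.
  by move=> z _; rewrite big_nil.
apply: (@Ck_ext _ _ _ _ _ (fun z : V => z 0 i *: row i Q + \sum_(j <- s) z 0 j *: row j Q)) => //.
  by move=> z _; rewrite big_cons.
by apply: CkD => //; apply: CkZ => //; exact: Ck_coord.
Qed.

Lemma omega_mx (u v : V) :
  omega u v = (lsubmx u *m (rsubmx v)^T - rsubmx u *m (lsubmx v)^T) 0 0.
Proof.
rewrite !mxE -sumrB; apply: eq_bigr => j _.
by rewrite !mxE.
Qed.

Lemma embeds_mulmx U W Q Q' : Q *m Q' = 1%:M ->
  (forall u v : V, omega (u *m Q) (v *m Q) = omega u v) ->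
  (forall z, U z -> W (z *m Q)) -> embeds_symplectically U W.
Proof.
move=> QQ' Qom UW; have cQ (M : 'M[R]_(n + n)) : continuous (fun z : V => z *m M).
    by move=> z; exact: (@Ck_mulmx 0%N setT M openT z Logic.I).
exists setT, (fun z => z *m Q); split => //.
- split; first exact: openT.
  + by move=> k; apply: Ck_mulmx; exact: openT.
  + exists (fun z => z *m Q'); first by move=> z _; rewrite -mulmxA QQ' mulmx1.
    by apply: continuous_subspaceT.
  + move=> z _ u v.
    have -> : 'd (fun z : V => z *m Q) z = (fun z => z *m Q) :> (V -> V).
      exact: (@diff_lin _ _ _ (mulmxr Q) z (cQ _)).
    exact: Qom.
- by move=> _ [z Uz <-]; exact: UW.
Qed.

Lemma embeds_subset U W : U `<=` W -> embeds_symplectically U W.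
Proof.
move=> UW; apply: (@embeds_mulmx _ _ 1%:M 1%:M); rewrite ?mulmx1//.
  by move=> u v; rewrite !mulmx1.
by move=> z /UW; rewrite mulmx1.
Qed.

Lemma embeds_orthogonal U W (B : 'M[R]_n) : orthogonal_matrix B ->
  (forall z, U z -> W (row_mx (lsubmx z *m B^T) (rsubmx z *m B^T))) ->
  embeds_symplectically U W.
Proof.
move=> hB UW.
have hB' : B^T *m B = 1%:M by exact: mulmx1C hB.
have QE (z : V) : z *m block_mx B^T 0 0 B^T = row_mx (lsubmx z *m B^T) (rsubmx z *m B^T).
  by rewrite -{1}[z]hsubmxK mul_row_block !mulmx0 addr0 add0r.
apply: (@embeds_mulmx _ _ (block_mx B^T 0 0 B^T) (block_mx B 0 0 B)).
- by rewrite mulmx_block !mulmx0 !mul0mx !addr0 !add0r hB' -scalar_mx_block.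
- move=> u v; rewrite !QE !omega_mx !row_mxKl !row_mxKr !trmx_mul !trmxK.
  by rewrite !mulmxA -!(mulmxA _ B^T B) hB' !mulmx1.
- by move=> z /UW; rewrite QE.
Qed.

End LinearEmbedding.

Section Capacity.
Context {R : realType} {n : nat}.
Notation V := 'rV[R]_(n + n).
Variable c : set V -> \bar R.
Hypothesis hc : normalized_symplectic_capacity c.
Local Open Scope ereal_scope.

Lemma capacity_subset (U W : set V) : U `<=` W -> c U <= c W.
Proof. by move=> UW; apply: (capacity_mono hc); exact: embeds_subset. Qed.

(** An arbitrary surplus [e] of area pays for enlarging the closed superellipse; letting it tend to
    0 leaves a non-strict bound. *)
Lemma capacity_ellipse_bound (B : 'M[R]_n) (p kap A : R) (i0 : 'I_n) (K : set V) :
  orthogonal_matrix B -> nat_of_ord i0 = 0%N ->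
  (2 < p)%R -> (0 < kap)%R -> (0 < A)%R ->
  lebesgue_tuple (@lp_body R p 2 1) = A%:E ->
  (forall z, K z -> `|(lsubmx z *m B^T) 0 i0| `^ p +
      (`|(rsubmx z *m B^T) 0 i0| / kap) `^ p <= 1)%R ->
  c K <= (kap * A)%:E.
Proof.
move=> hB i00 p2 kap0 A0 AE KP; apply/lee_addgt0Pr => e e0.
have pi0 : (0 < pi :> R)%R by exact: pi_gt0.
have kA0 : (0 < kap * A)%R by exact: mulr_gt0.
pose r := Num.sqrt ((kap * A + e) / pi).
have r2 : (pi * r ^+ 2 = kap * A + e)%R.
  have q0 : (0 <= (kap * A + e) / pi)%R by rewrite ltW// divr_gt0// addr_gt0.
  by rewrite sqr_sqrtr// mulrC divfK// gt_eqF.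
have r0 : (0 < r)%R by rewrite sqrtr_gt0 divr_gt0// addr_gt0.
have lt : (kap * A < pi * r ^+ 2)%R by rewrite r2 ltrDl.
have [a [h /= [ch [h0 hI] Ch hlt hK]]] := superellipse_profile p2 kap0 A0 AE lt.
have [G [G' [m [Gi [CG Cm P]]]]] := planar_coordinate r0 ch h0 hI Ch hlt.
pose K' := [set w : V | (`|w ord0 (lshift n i0)| `^ p +
      (`|w ord0 (rshift n i0)| / kap) `^ p <= 1)%R].
have cKK' : c K <= c K'.
  apply: (capacity_mono hc); apply: (embeds_orthogonal hB) => z /KP.
  by rewrite /K' /= row_mxEl row_mxEr.
apply: (le_trans cKK').
have oI : open [set x : R | (- a < x < a)%R].
  rewrite (_ : [set x | _] = `](- a)%R, a[%classic); first exact: interval_open.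
  by apply/seteqP; split => x; rewrite /= in_itv.
have emb : embeds_symplectically K' [set (r *: z)%R | z in @unit_cylinder R n].
  by apply: (embeds_cylinder i00 r0 oI CG Cm P) => w; exact: hK.
apply: (le_trans (capacity_mono hc emb)).
by rewrite (capacity_conformal hc)// (capacity_cylinder hc) -EFinM -EFinD mulrC r2.
Qed.

(** The closed ball contains the open one and lies in each of its dilates by a factor above 1, whose
    capacities tend to [pi] by conformality. *)
Lemma capacity_closed_ball (K : set V) :
  (forall z, K z <-> (\sum_(i < n + n) z 0 i ^+ 2 <= 1)%R) -> c K = (pi : R)%:E.
Proof.
move=> KE; apply/eqP; rewrite eq_le; apply/andP; split; last first.
  by rewrite -(capacity_ball hc); apply: capacity_subset => z /ltW /KE.
have pi0 : (0 < pi :> R)%R by exact: pi_gt0.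
apply/lee_addgt0Pr => e e0.
pose r := Num.sqrt ((pi + e) / pi).
have r2 : (r ^+ 2 = (pi + e) / pi)%R by rewrite sqr_sqrtr// ltW// divr_gt0// addr_gt0.
have r0 : (0 < r)%R by rewrite sqrtr_gt0 divr_gt0// addr_gt0.
have r21 : (1 < r ^+ 2)%R by rewrite r2 ltr_pdivlMr// mul1r ltrDl.
apply: (@le_trans _ _ (c [set (r *: z)%R | z in @euclidean_unit_ball R n])); last first.
  by rewrite (capacity_conformal hc)// (capacity_ball hc) -EFinM -EFinD r2 divfK// gt_eqF.
apply: capacity_subset => z /KE z1; exists (r^-1 *: z)%R; last first.
  by rewrite scalerA divff ?scale1r// gt_eqF.
rewrite /euclidean_unit_ball /=.
under eq_bigr do rewrite mxE exprMn exprVn.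
by rewrite -mulr_sumr ltr_pdivrMl ?mulr1; [exact: le_lt_trans r21|exact: lt_trans r21].
Qed.

End Capacity.

(** * The bodies *)

Section PowerMean.
Context {R : realType}.

(** The tangent line of [t^q] at 1, obtained from Young's inequality with second factor 1. *)
Lemma powR_tangent (q t : R) : 1 < q -> 0 <= t -> q * t - (q - 1) <= t `^ q.
Proof.
move=> q1 t0; have q0 : 0 < q by lra.
have q10 : 0 < q - 1 by lra.
have := @conjugate_powR R t 1 q (q / (q - 1)) t0 ler01 q0.
rewrite divr_gt0// invf_div one_powR mulr1 mul1r => /(_ isT).
have -> : q^-1 + (q - 1) / q = 1 by field; rewrite gt_eqF.
move=> /(_ erefl) h.
have : q * t <= q * (t `^ q / q + (q - 1) / q) by rewrite ler_pM2l.
rewrite mulrDr !(mulrC q) !divfK ?gt_eqF//; lra.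
Qed.

Lemma power_mean (n : nat) (p : R) (v : 'rV[R]_n) : (0 < n)%N -> 2 < p ->
  (\sum_i v 0 i ^+ 2) `^ (p / 2) <= n%:R `^ (p / 2 - 1) * \sum_i `|v 0 i| `^ p.
Proof.
move=> n0 p2; pose q := p / 2; rewrite -/q.
have p0 : 0 < p by lra.
have q1 : 1 < q by rewrite /q ltr_pdivlMr// mul1r.
have q0 : 0 < q by lra.
have nR : 0 < n%:R :> R by rewrite ltr0n.
pose S := \sum_i v 0 i ^+ 2.
have S0 : 0 <= S by apply: sumr_ge0 => i _; exact: sqr_ge0.
have absE (x : R) : `|x| `^ p = (x ^+ 2) `^ q.
  rewrite -[x ^+ 2]real_normK ?num_real// -powR_mulrn// -powRrM /q.
  by rewrite mulrCA divff// mulr1.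
rewrite -/S; move: S0; rewrite le_eqVlt => /predU1P[<-|S0].
  rewrite powR0 ?gt_eqF// mulr_ge0 ?powR_ge0// sumr_ge0// => i _; exact: powR_ge0.
pose m := S / n%:R.
have m0 : 0 < m by exact: divr_gt0.
(* Jensen's inequality, normalised by the mean [m] of the squares: the ratios [v_i^2 / m] sum to
   [n], so the tangent lines at 1 sum to [n] as well. *)
have h : n%:R <= \sum_i (v 0 i ^+ 2 / m) `^ q.
  have : \sum_i (q * (v 0 i ^+ 2 / m) - (q - 1)) <= \sum_i (v 0 i ^+ 2 / m) `^ q.
    by apply: ler_sum => i _; apply: powR_tangent => //; rewrite divr_ge0 ?sqr_ge0// ltW.
  apply: le_trans; rewrite sumrB -mulr_sumr -mulr_suml -/S sumr_const card_ord -[_ *+ n]mulr_natr.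
  have -> : S / m = n%:R by rewrite /m; field; rewrite !gt_eqF.
  by rewrite le_eqVlt; apply/orP; left; apply/eqP; ring.
have E : \sum_i (v 0 i ^+ 2 / m) `^ q = (\sum_i `|v 0 i| `^ p) * m `^ (- q).
  rewrite mulr_suml; apply: eq_bigr => i _.
  by rewrite absE powRM ?sqr_ge0 ?invr_ge0 ?(ltW m0)// -powR_inv1 ?(ltW m0)// -powRrM mulN1r.
move: h; rewrite E powRN ler_pdivlMr ?powR_gt0// => h.
have -> : S `^ q = n%:R `^ (q - 1) * (n%:R * m `^ q).
  rewrite mulrA [_ * n%:R]mulrC mulr_powRB1 ?(ltW nR)// -powRM ?(ltW nR) ?(ltW m0)//.
  by congr (_ `^ _); rewrite /m; field; rewrite gt_eqF.
by rewrite ler_wpM2l// powR_ge0.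
Qed.

End PowerMean.

Section LpBodies.
Context {R : realType}.

Definition row_lp_sum m (p : R) (v : 'rV[R]_m) : R := \sum_i `|v 0 i| `^ p.

Lemma lp_norm_powR m (p : R) (v : 'rV[R]_m) : 0 < p -> lp_norm p v `^ p = row_lp_sum p v.
Proof.
move=> p0; rewrite /lp_norm -powRrM mulVf ?gt_eqF// powRr1//.
by apply: sumr_ge0 => i _; exact: powR_ge0.
Qed.

Lemma row_lp_sum2 m (v : 'rV[R]_m) : row_lp_sum 2 v = \sum_i v 0 i ^+ 2.
Proof.
by apply: eq_bigr => i _; rewrite (powR_mulrn 2)// real_normK ?num_real.
Qed.

Lemma sum_sqr_mx m (v : 'rV[R]_m) : \sum_i v 0 i ^+ 2 = (v *m v^T) 0 0.
Proof. by rewrite mxE; apply: eq_bigr => i _; rewrite mxE expr2. Qed.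

Lemma sum_sqr_orthogonal m (Q : 'M[R]_m) (v : 'rV[R]_m) : Q *m Q^T = 1%:M ->
  \sum_i (v *m Q) 0 i ^+ 2 = \sum_i v 0 i ^+ 2.
Proof. by move=> hQ; rewrite !sum_sqr_mx trmx_mul mulmxA -(mulmxA v) hQ mulmx1. Qed.

Lemma row_lp_sum_tuple m (p : R) (t : m.-tuple (measurableTypeR R)) :
  row_lp_sum p (\row_(i < m) tnth t i) = lp_sum p t.
Proof. by apply: eq_bigr => i _; rewrite mxE. Qed.

Lemma Vol_lp_body m (p : R) :
  Vol [set v : 'rV[R]_m | row_lp_sum p v <= 1] = lebesgue_tuple (@lp_body R p m 1).
Proof.
by congr lebesgue_tuple; apply/seteqP; split => t; rewrite /= row_lp_sum_tuple.
Qed.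

Lemma row_measurable_lp_body m (p : R) :
  row_measurable [set v : 'rV[R]_m | row_lp_sum p v <= 1].
Proof.
rewrite /row_measurable (_ : [set t | _] = @lp_body R p m 1); first exact: measurable_lp_body.
by apply/seteqP; split => t; rewrite /= row_lp_sum_tuple.
Qed.

Section Kp.
Context {n : nat} (B D : 'M[R]_n).
Hypotheses (hB : orthogonal_matrix B) (hD : orthogonal_matrix D).
Let Q := block_mx B^T 0 0 D^T.

Let QQ : Q *m Q^T = 1%:M.
Proof.
rewrite tr_block_mx !trmxK !trmx0 mulmx_block !mulmx0 !mul0mx !addr0 !add0r.
by rewrite (mulmx1C hB) (mulmx1C hD) -scalar_mx_block.
Qed.

Lemma row_lp_sum_block (p : R) (z : 'rV[R]_(n + n)) :
  row_lp_sum p (z *m block_mx B^T 0 0 D^T) =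
  row_lp_sum p (lsubmx z *m B^T) + row_lp_sum p (rsubmx z *m D^T).
Proof.
have -> : z *m block_mx B^T 0 0 D^T = row_mx (lsubmx z *m B^T) (rsubmx z *m D^T).
  by rewrite -{1}[z]hsubmxK mul_row_block !mulmx0 addr0 add0r.
rewrite {1}/row_lp_sum big_split_ord; congr +%R; apply: eq_bigr => i _.
  by rewrite row_mxEl.
by rewrite row_mxEr.
Qed.

Lemma KpE (p : R) : 0 < p ->
  Kp p B D = [set z | row_lp_sum p (z *m block_mx B^T 0 0 D^T) <= 1].
Proof.
move=> p0; rewrite /Kp; apply: eq_set => z.
rewrite row_lp_sum_block; congr (_ + _ <= _); exact: lp_norm_powR.
Qed.

(** The reference set for [Vol_mulmx] is the Euclidean ball: it is symmetric, invariant under [Q],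
    and of known volume. *)
Lemma Vol_Kp (p : R) : 0 < p -> Vol (Kp p B D) = lebesgue_tuple (@lp_body R p (n + n) 1).
Proof.
move=> p0; rewrite KpE// -Vol_lp_body.
apply: (@Vol_mulmx _ _ Q Q^T [set v | row_lp_sum 2 v <= 1] [set v | row_lp_sum p v <= 1]).
- exact: mulmx1C QQ.
- exact: row_measurable_lp_body.
- exact: row_measurable_lp_body.
- by move=> v; rewrite /= !row_lp_sum2; under [in X in _ -> X]eq_bigr do rewrite mxE sqrrN.
- by move=> v; rewrite /= !row_lp_sum2 sum_sqr_orthogonal.
- rewrite Vol_lp_body addnn lebesgue_ball_even lte_fin ltry andbT.
  by rewrite divr_gt0// ?exprn_gt0 ?pi_gt0// ltr0n fact_gt0.
Qed.

Lemma KpP (p : R) (z : 'rV[R]_(n + n)) : 0 < p ->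
  Kp p B D z <-> row_lp_sum p (lsubmx z *m B^T) + row_lp_sum p (rsubmx z *m D^T) <= 1.
Proof. by move=> p0; rewrite KpE// -row_lp_sum_block. Qed.

Lemma Kp2P (z : 'rV[R]_(n + n)) : Kp 2 B D z <-> \sum_(i < n + n) z 0 i ^+ 2 <= 1.
Proof. by rewrite KpE// -(sum_sqr_orthogonal z QQ) -row_lp_sum2. Qed.

End Kp.
End LpBodies.

(** Pairing the factor [i + 1] with [n - i] in the two factorials gives [n] products, each at least
    [n]. *)
Lemma expnn_leq_sqr_fact n : (n ^ n <= n`! ^ 2)%N.
Proof.
have E : (n`! ^ 2 = \prod_(i < n) (i.+1 * (n - i)))%N.
  rewrite big_split /= -mulnn fact_prod big_add1 /= big_mkord; congr muln.
  rewrite [LHS](reindex_inj rev_ord_inj) /=; apply: eq_bigr => i _.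
  by rewrite subnSK.
rewrite E -[X in (X ^ _)%N]/n -{2}(card_ord n) -prod_nat_const.
apply: leq_prod => i _; rewrite -subnSK// mulnS.
by rewrite -{1}(subnKC (ltn_ord i)) leq_add2l leq_pmull.
Qed.

Lemma powR_expnn_le_fact {R : realType} (p : R) (n : nat) : 2 < p -> (0 < n)%N ->
  (n%:R `^ (2^-1 - p^-1)) ^+ n <= n`!%:R * n`!%:R `^ (- (2 / p)) :> R.
Proof.
move=> p2 n0; have p0 : 0 < p by lra.
have f0 : 0 < n`!%:R :> R by rewrite ltr0n fact_gt0.
have e0 : 0 <= 2^-1 - p^-1 by rewrite subr_ge0 lef_pV2 ?posrE//; lra.
have -> : n`!%:R * n`!%:R `^ (- (2 / p)) = (n`!%:R ^+ 2) `^ (2^-1 - p^-1) :> R.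
  rewrite -{1}[n`!%:R](powRr1 (ltW f0)) -powRD; last by rewrite (gt_eqF f0) implybT.
  by rewrite -powR_mulrn ?ltW// -powRrM; congr (_ `^ _); field; rewrite gt_eqF.
rewrite -powR_mulrn ?powR_ge0// powRAC powR_mulrn//.
apply: ge0_ler_powR; rewrite ?nnegrE ?exprn_ge0//.
by rewrite -!natrX ler_nat expnn_leq_sqr_fact.
Qed.

(** The body contains the unit disc, since [|t|^p <= |t|^2] when [|t| <= 1]. *)
Lemma lp_area_gt0 {R : realType} (p : R) : 2 < p ->
  (0 < lebesgue_tuple (@lp_body R p 2 1))%E.
Proof.
move=> p2; apply: (@lt_le_trans _ _ (pi : R)%:E); first by rewrite lte_fin pi_gt0.
rewrite -lebesgue_disc; apply: le_measure; rewrite ?inE; try exact: measurable_lp_body.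
move=> t; rewrite /lp_body /= => t1; apply: (le_trans _ t1); apply: ler_sum => i _.
have ti : `|tnth t i| `^ 2 <= 1.
  apply: le_trans t1; rewrite /lp_sum (bigD1 i)//= lerDl.
  by apply: sumr_ge0 => j _; exact: powR_ge0.
have [->|t0] := eqVneq (tnth t i) 0; first by rewrite normr0 !powR0 ?gt_eqF//; lra.
apply: ger_powR; last exact: ltW.
by rewrite normr_gt0 t0 /=; move: ti; rewrite powR_le_inv// one_powR.
Qed.

Lemma capacity_Kp_lt (R : realType) (n : nat) (B D : 'M[R]_n) (p : R)
    (c : set 'rV[R]_(n + n) -> \bar R) :
  (1 < n)%N -> orthogonal_matrix B -> orthogonal_matrix D -> 2 < p ->
  normalized_symplectic_capacity c ->
  (c (Kp p B D) ^+ n < (n`!)%:R%:E * Vol (Kp p B D))%E.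
Proof.
move=> n1 hB hD p2 hc.
have p0 : 0 < p by lra.
have n0 : (0 < n)%N by exact: ltn_trans n1.
have nR : 0 < n%:R :> R by rewrite ltr0n.
pose i0 : 'I_n := Ordinal n0.
have f0 : 0 < n`!%:R :> R by rewrite ltr0n fact_gt0.
pose q := p / 2.
have q0 : 0 < q by rewrite divr_gt0.
have [A AE] : exists A : R, lebesgue_tuple (@lp_body R p 2 1) = A%:E.
  by exists (fine (lebesgue_tuple (@lp_body R p 2 1))); rewrite fineK// lebesgue_tuple2_fin_num.
have A0 : 0 < A by have := @lp_area_gt0 R p p2; rewrite AE lte_fin.
pose kap := n%:R `^ (2^-1 - p^-1) : R.
have kap0 : 0 < kap by exact: powR_gt0.
have kapp : kap `^ p = n%:R `^ (q - 1).
  by rewrite /kap -powRrM; congr (_ `^ _); rewrite /q; field; rewrite gt_eqF.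
have absE (x : R) : `|x| `^ p = (x ^+ 2) `^ q.
  rewrite -[x ^+ 2]real_normK ?num_real// -powR_mulrn// -powRrM /q.
  by rewrite mulrCA divff// mulr1.
have hB' : B^T *m B = 1%:M by exact: mulmx1C hB.
have hD' : D^T *m D = 1%:M by exact: mulmx1C hD.
have cle : (c (Kp p B D) <= (kap * A)%:E)%E.
  apply: (@capacity_ellipse_bound _ _ _ hc B p kap A i0) => // z /(KpP B D z p0).
  apply: le_trans; apply: lerD.
    by rewrite /row_lp_sum (bigD1 i0)//= lerDl; apply: sumr_ge0 => j _; exact: powR_ge0.
  rewrite powRM ?invr_ge0 ?(ltW kap0)// -powR_inv1 ?(ltW kap0)// powRAC powR_inv1 ?powR_ge0//.
  rewrite ler_pdivrMr ?powR_gt0// kapp mulrC.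
  apply: le_trans (power_mean _ n0 p2); rewrite -/q absE.
  apply: ge0_ler_powR; rewrite ?nnegrE ?(ltW q0) ?sqr_ge0//.
    by apply: sumr_ge0 => j _; exact: sqr_ge0.
  (* Here [D] is exchanged for [B], through the Euclidean norm that both preserve. *)
  have -> : \sum_i (rsubmx z *m D^T) 0 i ^+ 2 = \sum_i (rsubmx z *m B^T) 0 i ^+ 2.
    by rewrite !sum_sqr_orthogonal ?trmxK.
  by rewrite (bigD1 i0)//= lerDl; apply: sumr_ge0 => j _; exact: sqr_ge0.
(* Nonnegativity and the upper bound make the capacity a real number, so the [n]-th powers are
   compared in [R]. *)
have := capacity_ge0 hc (Kp p B D).
move: cle; case: (c (Kp p B D)) => [x| |]//; rewrite !lee_fin => xle x0.
rewrite -EFin_expe (Vol_Kp hB hD p0) addnn.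
apply: (@le_lt_trans _ _ (n`!%:R%:E * (n`!%:R `^ (- (2 / p)) * A ^+ n)%:E)%E); last first.
  by rewrite lte_pmul2l ?lte_fin//; exact: lebesgue_lp_body_even_gt.
rewrite -EFinM lee_fin mulrA; apply: (@le_trans _ _ (kap ^+ n * A ^+ n)).
  by rewrite -exprMn lerXn2r// nnegrE// ltW// mulr_gt0.
by rewrite ler_pM2r ?exprn_gt0//; exact: powR_expnn_le_fact.
Qed.

Theorem theorem7 (R : realType) (n : nat) (hn : (1 < n)%N) (B D : 'M[R]_n)
    (hB : orthogonal_matrix B) (hD : orthogonal_matrix D) :
  (forall p : R, 2 < p ->
     forall c : set 'rV[R]_(n + n) -> \bar R,
       normalized_symplectic_capacity c ->
       (c (Kp p B D) ^+ n < (n`!)%:R%:E * Vol (Kp p B D))%E)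
  /\
  (forall c : set 'rV[R]_(n + n) -> \bar R,
     normalized_symplectic_capacity c ->
     (c (Kp 2 B D) ^+ n = (n`!)%:R%:E * Vol (Kp 2 B D))%E).
Proof.
split=> [p p2 c hc|c hc]; first exact: capacity_Kp_lt.
rewrite (capacity_closed_ball hc (Kp2P hB hD)) (Vol_Kp hB hD)// addnn lebesgue_ball_even.
rewrite -EFin_expe -EFinM mulrC divfK// pnatr_eq0 -lt0n fact_gt0//.
Qed.
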